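(* Let $S\subseteq[n-1]$, and let $\rho,\sigma\in\mathfrak S_n$ with $w_0(S)\preceq_L\rho$ and $\sigma\preceq_L w_1(S)$. Let $C_{S;\rho}$ and $C_{\sigma;S}$ be the $\sim_D$-equivalence classes in $\mathrm{Int}(n)$ of $[w_0(S),\rho]_L$ and $[\sigma,w_1(S)]_L$, respectively. Then: (a) $\min C_{S;\rho}=[w_0(S),\rho]_L$ and $\max C_{S;\rho}=\Sigma_L\big(P_{F^{\nearrow}_{D_{S;\rho}}}\big)$. (b) $\min C_{\sigma;S}=\Sigma_L\big(P_{F^{\swarrow}_{D_{\sigma;S}}}\big)$ and $\max C_{\sigma;S}=[\sigma,w_1(S)]_L$.
   Context: Permutations. $n$ is a positive integer, $[n]=\{1,\dots,n\}$, $\mathfrak S_n$ the symmetric group (product = composition of maps), $s_i=(i,i+1)$, $\ell$ Coxeter length, $w_0$ the longest element. $\mathrm{Des}_L(\sigma)=\{i:\ell(s_i\sigma)<\ell(\sigma)\}$, $\mathrm{Des}_R(\sigma)=\{i:\ell(\sigma s_i)<\ell(\sigma)\}$. $\preceq_L$ (resp. $\preceq_R$) has covers $\sigma\prec s_i\sigma$, $i\notin\mathrm{Des}_L(\sigma)$ (resp. $\sigma\prec\sigma s_i$, $i\notin\mathrm{Des}_R(\sigma)$); $[\sigma,\rho]_L$ is the interval for $\preceq_L$. For $S\subseteq[n-1]$, $S^{c}=[n-1]\setminus S$; $w_0(S)$ is the longest element of the subgroup generated by $\{s_i:i\in S\}$; $w_1(S)=w_0w_0(S^c)$ is the longest element of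 $\{z:\mathrm{Des}_R(z)\subseteq S\}$. Classes. $\mathrm{Int}(n)$ is the set of nonempty intervals $[\sigma,\rho]_L$. $I_1\sim_D I_2$ iff there is a poset isomorphism $f:(I_1,\preceq_L)\to(I_2,\preceq_L)$ with $\mathrm{Des}_L(f(\gamma))=\mathrm{Des}_L(\gamma)$ for all $\gamma$. On an equivalence class $C$ put $[\sigma,\rho]_L\preceq[\sigma',\rho']_L$ iff $\sigma\preceq_R\sigma'$; it is known that $(C,\preceq)$ has a minimum $\min C$ and a maximum $\max C$. Posets and fillings. For a poset $P$ on $[n]$, $\Sigma_L(P)=\{\sigma\in\mathfrak S_n:\sigma(i)\le\sigma(j)\text{ whenever }i\preceq_P j\}$. $\mathfrak D_n$ is the set of $n$-element subsets $D\subset\mathbb Z_{>0}^2$ (boxes $(x,y)$, $x$ = column index from the left, $y$ = row index from the bottom) such that, up to the number of columns and rows, no column or row is empty. A standard filling of $D$ is a bijection $F:D\to[n]$; $P_F$ is the poset on $[n]$ with $i\preceq j$ iff $x_i\le x_j$ and $y_i\le y_j$, where $(x_i,y_i)=F^{-1}(i)$. $F_D^{\downarrow}$ is the standard filling placing $1,2,\dots,n$ down each column (top to bottom), starting with the leftmost column. The filling $F_D^{\nearrow}$. Define $Z_0=F_D^{\downarrow}$ and, for $i=1,\dots,n$, $Z_i$ from $Z_{i-1}$: if there is an entry $x>i$ in $Z_{i-1}$ such that (i) $x$ is strictly above and to the right of $i$, and (ii) for each $j=i,i+1,\dots,x-1$ the entry $j$ is strictly below and weakly left of $x$ and is not in covering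 relation with $x$ in $P_{Z_{i-1}}$, then let $\mathbf x$ be the uppermost such $x$, and let $Z_i$ be obtained by increasing the entries $i,\dots,\mathbf x-1$ by $1$ and putting $i$ in the box that contained $\mathbf x$; otherwise $Z_i=Z_{i-1}$. Set $F_D^{\nearrow}:=Z_n$. The diagram $D_{S;\rho}$ (for $w_0(S)\preceq_L\rho$). Write $S^c=\{z_1<\dots<z_p\}$, $z_0=0$, $z_{p+1}=n$, and $\mathrm{Des}_L(\rho)=\{q_1<\dots<q_e\}$, $q_0=0$, $q_{e+1}=n$. Let $X_i=\{\rho(r):z_{i-1}+1\le r\le z_i\}$ and $Y_j=\{c:q_{j-1}+1\le c\le q_j\}$. Then $D_{S;\rho}=\{(i,j):X_i\cap Y_j\ne\emptyset\}$. The diagram $D_{\sigma;S}$ (for $\sigma\preceq_L w_1(S)$). Write $S=\{z_1<\dots<z_p\}$, $z_0=0$, $z_{p+1}=n$, and $[n-1]\setminus\mathrm{Des}_L(\sigma)=\{q_1<\dots<q_e\}$, $q_0=0$, $q_{e+1}=n$. Then $D_{\sigma;S}=\{(j,p+2-i):\{\sigma(r):z_{i-1}<r\le z_i\}\cap\{q_{j-1}+1,\dots,q_j\}\ne\emptyset\}$. Equivalently $D_{\sigma;S}=(D_{S^c;w_0\sigma})^*$, where for $D$ with $r$ rows and $c$ columns $D^*=\{(r-j+1,c-i+1):(i,j)\in D\}$ (reflection across $y=-x$ and shift). For a standard filling $F$ of $D$, $F^*$ is the standard filling of $D^*$ with $F^*(r-j+1,c-i+1)=F(i,j)$. Set $F^{\swarrow}_{D_{\sigma;S}}:=\big(F^{\nearrow}_{D_{S^c;w_0\sigma}}\big)^*$.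 *)

(* Defs.v *)
From mathcomp Require Import all_boot all_fingroup.
From mathcomp Require Import finmap.

Set Implicit Arguments.
Unset Strict Implicit.
Unset Printing Implicit Defensive.

(* The set [n] = {1, ..., n} is modelled by 'I_n = {0, ..., n-1}: the element k
   of [n] is the ordinal of value k-1.  Likewise the index i of [n-1] is the
   ordinal of value i-1 in 'I_n.-1.  Columns and rows of boxes are natural
   numbers numbered from 1. *)

Section Permutations.

Variable n : nat.
Implicit Types (i : 'I_n.-1) (S : {set 'I_n.-1}) (s t r : 'S_n).
Implicit Types (I J : {set 'S_n}).

(* Product of permutations as composition of maps, (s ** t) x = s (t x);
   the product of the perm library composes in the opposite order. *)
Definition compp s t : 'S_n := (t * s)%g.
Local Notation "s ** t" := (compp s t) (at level 40, left associativity).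

Definition lo i : 'I_n := widen_ord (leq_pred n) i.

Definition hi i : 'I_n := Ordinal (etrans (esym (ltn_predRL i n)) (ltn_ord i)).

Definition refl i : 'S_n := tperm (lo i) (hi i).

Definition word_prod (w : seq 'I_n.-1) : 'S_n :=
  foldr (fun i s => refl i ** s) 1%g w.

Definition has_word s (k : nat) : bool :=
  [exists w : k.-tuple 'I_n.-1, word_prod w == s].

Lemma has_wordP s k :
  reflect (exists2 w, size w = k & word_prod w = s) (has_word s k).
Proof.
apply: (iffP existsP) => [[w /eqP ws]|[w wk ws]].
  by exists w; rewrite ?size_tuple.
have wk' : size w == k by rewrite wk.
by exists (Tuple wk'); apply/eqP.
Qed.

Lemma word_prod_cat u v : word_prod (u ++ v) = word_prod u ** word_prod v.
Proof.
elim: u => [|i u IHu] /=; first by rewrite /compp mulg1.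
by rewrite IHu /compp mulgA.
Qed.

Lemma ex_wordM s t : (exists w, word_prod w = s) ->
  (exists w, word_prod w = t) -> exists w, word_prod w = (s * t)%g.
Proof.
by move=> [u us] [v vt]; exists (v ++ u); rewrite word_prod_cat us vt.
Qed.

Lemma ex_word_refl i : exists w, word_prod w = refl i.
Proof. by exists [:: i]; rewrite /= /compp mul1g. Qed.

Lemma ex_word_tperm d (x y : 'I_n) :
  y = x + d :> nat -> exists w, word_prod w = tperm x y.
Proof.
elim: d y => [|d IHd] y yxd.
  have -> : y = x by apply: val_inj; rewrite /= yxd addn0.
  by exists [::]; rewrite tperm1.
have y1 : y.-1 < n.-1 by rewrite ltn_predRL prednK ?ltn_ord // yxd addnS.
pose i := Ordinal y1.
have hiE : hi i = y by apply: val_inj; rewrite /= prednK // yxd addnS.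
have loE : lo i = x + d :> nat by rewrite /= yxd addnS.
case: (posnP d) => [d0|d_gt0].
  have xE : lo i = x by apply: ord_inj; rewrite loE d0 addn0.
  by have := ex_word_refl i; rewrite /refl xE hiE.
have xNlo : x != lo i.
  by apply: contraTneq d_gt0 => xlo; rewrite -(ltn_add2l x) addn0 -loE -xlo ltnn.
have xNhi : x != hi i.
  rewrite hiE; apply: contraTneq (ltn0Sn d) => xy.
  by rewrite -(ltn_add2l x) addn0 -yxd -xy ltnn.
have -> : tperm x y = (tperm x (lo i) ^ refl i)%g.
  by rewrite tpermJ /refl tpermL hiE tpermD // eq_sym // -hiE.
rewrite conjgE tpermV.
exact: ex_wordM (ex_word_refl i) (ex_wordM (IHd _ loE) (ex_word_refl i)).
Qed.

Lemma ex_has_word s : exists k, has_word s k.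
Proof.
suff [w ws] : exists w, word_prod w = s.
  by exists (size w); apply/has_wordP; exists w.
have [ts -> _] := prod_tpermP s.
elim: ts => [|[x y] ts IHts]; first by rewrite big_nil; exists [::].
rewrite big_cons; apply: ex_wordM IHts => /=.
have [le_xy|/ltnW le_yx] := leqP x y.
  by apply: (@ex_word_tperm (y - x)); rewrite subnKC.
by rewrite tpermC; apply: (@ex_word_tperm (x - y)); rewrite subnKC.
Qed.

Definition len s : nat := ex_minn (ex_has_word s).

Definition DesL s : {set 'I_n.-1} := [set i | len (refl i ** s) < len s].
Definition DesR s : {set 'I_n.-1} := [set i | len (s ** refl i) < len s].

Definition coverL : rel 'S_n :=
  fun s t => [exists i, (i \notin DesL s) && (t == refl i ** s)].
Definition coverR : rel 'S_n :=
  fun s t => [exists i, (i \notin DesR s) && (t == s ** refl i)].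

Definition leL : rel 'S_n := connect coverL.
Definition leR : rel 'S_n := connect coverR.

Definition intervalL s r : {set 'S_n} := [set t | leL s t && leL t r].

Definition w0_of S : 'S_n :=
  [arg max_(w > 1%g in <<[set refl i | i in S]>>%g) len w].

Definition w0 : 'S_n := [arg max_(w > 1%g) len w].

Definition w1_of S : 'S_n := w0 ** w0_of (~: S).

Definition Int : {set {set 'S_n}} :=
  [set I : {set 'S_n} |
     (I != set0) && [exists s, exists r, I == intervalL s r]].

Definition simD I J : Prop :=
  exists f : 'S_n -> 'S_n,
    [/\ {in I &, injective f}, f @: I = J,
        {in I &, forall s t, leL (f s) (f t) = leL s t}
      & {in I, forall s, DesL (f s) = DesL s}].

Definition classD I : {set 'S_n} -> Prop := fun J => J \in Int /\ simD J I.

Definition le_class I J : Prop :=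
  exists s r s' r',
    [/\ I = intervalL s r, leL s r, J = intervalL s' r', leL s' r'
      & leR s s'].

Definition is_min_class (C : {set 'S_n} -> Prop) I : Prop :=
  C I /\ forall J, C J -> le_class I J.

Definition is_max_class (C : {set 'S_n} -> Prop) I : Prop :=
  C I /\ forall J, C J -> le_class J I.

Definition SigmaL (P : rel 'I_n) : {set 'S_n} :=
  [set s : 'S_n | [forall i, forall j, P i j ==> (s i <= s j)]].

End Permutations.

Notation "s ** t" := (compp s t) (at level 40, left associativity).

Local Open Scope fset_scope.
Local Open Scope nat_scope.

Definition diagram := {fset nat * nat}.

(* A filling is a total function on boxes, meaningful on the boxes of the
   diagram D only; its entries are numbered from 0, as in 'I_n.  It is a
   standard filling of D when it restricts to a bijection from D to
   {0, ..., n-1}. *)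
Definition filling := nat * nat -> nat.

Definition num_cols (D : diagram) : nat := #|` [fset b.1 | b in D]|.
Definition num_rows (D : diagram) : nat := #|` [fset b.2 | b in D]|.

(* (i, j) |-> (r - j + 1, c - i + 1), for c columns and r rows; its inverse is
   flip r c, as the image diagram has r columns and c rows. *)
Definition flip (c r : nat) (b : nat * nat) : nat * nat :=
  (r - b.2 + 1, c - b.1 + 1).

Definition star (D : diagram) : diagram :=
  [fset flip (num_cols D) (num_rows D) b | b in D].

Definition star_fill (D : diagram) (F : filling) : filling :=
  fun b => F (flip (num_rows D) (num_cols D) b).

(* F^{-1} on D, with a dummy value on numbers that are not entries of D. *)
Definition box_of (D : diagram) (F : filling) (i : nat) : nat * nat :=
  let bs : seq (nat * nat) := D in
  nth (0, 0) bs (find (fun b => F b == i) bs).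

Definition fill_poset (n : nat) (D : diagram) (F : filling) : rel 'I_n :=
  fun i j => ((box_of D F i).1 <= (box_of D F j).1)
          && ((box_of D F i).2 <= (box_of D F j).2).

Definition covers (T : finType) (P : rel T) (x y : T) : bool :=
  [&& x != y, P x y
    & [forall z, P x z ==> P z y ==> ((z == x) || (z == y))]].

Definition fill_down (D : diagram) : filling :=
  fun b => #|` [fset c in D | (c.1 < b.1) || ((c.1 == b.1) && (b.2 < c.2))]|.

Section NorthEast.

Variables (n : nat) (D : diagram).

Definition ne_candidate (F : filling) (i x : 'I_n) : bool :=
  let col k := (box_of D F k).1 in
  let row k := (box_of D F k).2 in
  let P := fill_poset D F in
  [&& i < x, (row i < row x) && (col i < col x)
    & [forall j : 'I_n, (i <= j < x) ==>
         [&& row j < row x, col j <= col x, ~~ covers P j x & ~~ covers P x j]]].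

Definition ne_choice (F : filling) (i : 'I_n) : option 'I_n :=
  [pick x | ne_candidate F i x &&
     [forall y, ne_candidate F i y ==>
        ((box_of D F y).2 <= (box_of D F x).2)]].

Definition ne_step (F : filling) (i : 'I_n) : filling :=
  if ne_choice F i is Some x then
    fun b => if F b == x then i : nat
             else if i <= F b < x then (F b).+1
             else F b
  else F.

Definition fill_ne : filling := foldl ne_step (fill_down D) (enum 'I_n).

End NorthEast.

Section Diagrams.

Variable n : nat.
Implicit Types (S : {set 'I_n.-1}) (s r : 'S_n).

(* For S = {z_1 < ... < z_p}, the sequence z_0 = 0, z_1, ..., z_p, z_{p+1} = n. *)
Definition cuts S : seq nat := 0 :: rcons [seq (val i).+1 | i <- enum S] n.

(* The elements k of [n] with z_{i-1} < k <= z_i; an ordinal k stands for k+1. *)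
Definition block S (i : nat) : {set 'I_n} :=
  [set k : 'I_n | nth 0 (cuts S) i.-1 < k.+1 <= nth 0 (cuts S) i].

Definition diag_above S r : diagram :=
  [fset b in [seq (i, j) | i <- iota 1 #|~: S|.+1, j <- iota 1 #|DesL r|.+1]
     | (r @: block (~: S) b.1 :&: block (DesL r) b.2)%SET != set0].

Definition diag_below s S : diagram :=
  [fset (b.2, #|S| + 2 - b.1)
     | b in [seq (i, j) | i <- iota 1 #|S|.+1, j <- iota 1 #|~: DesL s|.+1]
     & (s @: block S b.1 :&: block (~: DesL s) b.2)%SET != set0].

(* A filling of diag_below s S, which is star (diag_above (~: S) (w0 n ** s)). *)
Definition fill_sw s S : filling :=
  let D := diag_above (~: S) (w0 n ** s) in star_fill D (fill_ne n D).

End Diagrams.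

(* Main.v *)
Require Import Defs.
From mathcomp Require Import all_boot all_fingroup.
From mathcomp Require Import finmap zify.

(* Write Q for the poset on positions whose linear extensions form [s, r]_L.
   An element of the class of [s, r]_L is a right translate of it, since
   Des_L(s_i g) \ Des_L(g) = {i} forces an isomorphism to commute with the
   covers g -> s_i g; so the class is the set of relabellings phi of Q that keep
   the order of the labels of every pair incomparable in Q or in a covering
   relation of Q, and the order on the class is inclusion of the set of pairs
   x <_Q y with phi y < phi x.  A position is identified with its box, its label
   being the entry of F_D^down, and Q is then the componentwise order of boxes.
   Let R be the transitive closure of the constraints x -> y (x < y not
   separated in Q).  If m lies strictly between x and y in Q and x R y, then
   x R m or m R y.  Step i of the construction of F_D^NE moves to place i the
   uppermost R-minimal box among those not yet placed; hence a box x with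
   x <_Q y precedes y only if x R y, which is maximality.  Part (b) follows from
   part (a) by left multiplication by w_0, which preserves the constraints and
   reverses both orders. *)

Set Implicit Arguments.
Unset Strict Implicit.
Unset Printing Implicit Defensive.

(** * Length as number of inversions, and the left order as inclusion of inversion sets *)

Section WeakOrder.

Variable n : nat.
Implicit Types (i : 'I_n.-1) (s t r : 'S_n) (x y z : 'I_n).

Lemma comppE s t x : (s ** t) x = s (t x).
Proof. by rewrite /compp permM. Qed.

Lemma comppA s t r : s ** (t ** r) = (s ** t) ** r.
Proof. by rewrite /compp mulgA. Qed.

Lemma comppK s t : (s ** t) ** t^-1%g = s.
Proof. by rewrite /compp mulgA mulVg mul1g. Qed.

Lemma comppKV s t : (s ** t^-1%g) ** t = s.
Proof. by rewrite /compp mulgA mulgV mul1g. Qed.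

Lemma card_ord_lt k : k <= n -> #|[set v : 'I_n | v < k]| = k.
Proof.
move=> kn; rewrite -sum1dep_card.
by rewrite -(big_ord_widen_cond _ xpredT (fun=> 1) kn) sum1_card card_ord.
Qed.

Lemma perm_rank s x : #|[set y | s y < s x]| = s x.
Proof.
rewrite -[RHS](@card_ord_lt (s x)) 1?ltnW //.
rewrite -(card_preimset [set v : 'I_n | v < s x] (@perm_inj _ s)).
by apply: eq_card => y; rewrite !inE.
Qed.

Lemma perm_eq_order s t : (forall x y, (s x < s y) = (t x < t y)) -> s = t.
Proof.
move=> st; apply/permP => x; apply: val_inj; rewrite /= -(perm_rank s) -(perm_rank t).
by apply: eq_card => y; rewrite !inE st.
Qed.

Lemma perm_lt_neq s x y : x != y -> (s x < s y) = ~~ (s y < s x).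
Proof.
move=> xy; rewrite -leqNgt ltn_neqAle.
by rewrite (inj_eq val_inj) (inj_eq perm_inj) xy.
Qed.

(** Standardization of an injective key: [x] is sent to the number of keys below its own. *)
Lemma perm_of_order (k : 'I_n -> nat) : injective k ->
  exists s : 'S_n, forall x y, (s x < s y) = (k x < k y).
Proof.
move=> kI; pose A x := [set w | k w < k x].
have rk x : #|A x| < n.
  rewrite -[ltnRHS]card_ord -cardsT; apply: proper_card.
  by rewrite properT; apply/eqP => /setP/(_ x); rewrite !inE ltnn.
have lt x y : k x < k y -> #|A x| < #|A y|.
  move=> xy; apply: proper_card; apply/properP; split.
    by apply/subsetP => w; rewrite !inE => /ltn_trans; apply.
  by exists x; rewrite !inE // ltnn.
have ltE x y : (#|A x| < #|A y|) = (k x < k y).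
  apply/idP/idP; last exact: lt.
  by case: (ltngtP (k x) (k y)) => // [/lt|/kI->]; rewrite ?ltnn //; case: ltngtP.
have fI : injective (fun x => Ordinal (rk x)).
  move=> x y [] exy; apply: kI; apply/eqP.
  by rewrite eqn_leq leqNgt -ltE exy ltnn leqNgt -ltE exy ltnn.
by exists (perm fI) => x y; rewrite !permE ltE.
Qed.

Lemma lo_hi i : hi i = (lo i).+1 :> nat.
Proof. by []. Qed.

Lemma ex_lo x y : y = x.+1 :> nat -> exists i, lo i = x /\ hi i = y.
Proof.
move=> yx; have xn : x < n.-1 by rewrite ltn_predRL -yx.
by exists (Ordinal xn); split; apply: val_inj.
Qed.

Lemma reflK i x : refl i (refl i x) = x.
Proof. by rewrite /refl tpermK. Qed.

Lemma refl_comppK i s : refl i ** (refl i ** s) = s.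
Proof. by apply/permP => x; rewrite !comppE reflK. Qed.

Lemma refl_lt i x y : (x, y) != (lo i, hi i) -> (x, y) != (hi i, lo i) ->
  (refl i x < refl i y) = (x < y).
Proof.
rewrite !xpair_eqE /refl; have := lo_hi i; move: (lo i) (hi i) => a b ab.
rewrite -!val_eqE /=.
by case: tpermP => [->|->|/eqP + /eqP]; case: tpermP => [->|->|/eqP + /eqP];
  rewrite -?val_eqE /=; lia.
Qed.

Lemma lt_all_eq1 s : (forall i, s (lo i) < s (hi i)) -> s = 1%g.
Proof.
move=> sI; have lt d x y : y = x + d.+1 :> nat -> s x < s y.
  elim: d x y => [|d IHd] x y yx.
    have [i [<- <-]] : exists i, lo i = x /\ hi i = y by apply: ex_lo; lia.
    exact: sI.
  have zn : x.+1 < n by have := ltn_ord y; lia.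
  have zx : Ordinal zn = x.+1 :> nat by [].
  have [i [lx hx]] := ex_lo zx.
  have := sI i; rewrite lx hx => /ltn_trans; apply; apply: IHd; rewrite /=; lia.
have lt' x y : x < y -> s x < s y by move=> xy; apply: (lt (y - x).-1); lia.
apply: perm_eq_order => x y; rewrite !perm1; apply/idP/idP => [|/lt' //].
by case: (ltngtP x y) => // [/lt'|/val_inj ->]; rewrite ?ltnn //; case: ltngtP.
Qed.

(** Pairs of positions rather than of values: left multiplication by [refl i] swaps two consecutive
    values, so it changes the status of a single pair. *)
Definition inversions s := [set p : 'I_n * 'I_n | (p.1 < p.2) && (s p.2 < s p.1)].

Lemma inversions_asc i s : s^-1%g (lo i) < s^-1%g (hi i) ->
  inversions (refl i ** s) = (s^-1%g (lo i), s^-1%g (hi i)) |: inversions s.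
Proof.
move=> asc; apply/setP => -[x y]; rewrite !inE !comppE /= xpair_eqE.
rewrite -(inj_eq (@perm_inj _ s) x) -(inj_eq (@perm_inj _ s) y) !permKV.
have [/andP[/eqP sx /eqP sy]|ne1] := boolP ((s x == lo i) && (s y == hi i)).
  have -> : x = s^-1%g (lo i) by rewrite -sx permK.
  have -> : y = s^-1%g (hi i) by rewrite -sy permK.
  by rewrite asc !permKV /refl tpermL tpermR /= ltnSn.
have [/andP[/eqP sx /eqP sy]|ne2] := boolP ((s x == hi i) && (s y == lo i)).
  have -> : x = s^-1%g (hi i) by rewrite -sx permK.
  have -> : y = s^-1%g (lo i) by rewrite -sy permK.
  by rewrite ltnNge ltnW.
by rewrite refl_lt // xpair_eqE andbC.
Qed.

Lemma card_inversions_asc i s : s^-1%g (lo i) < s^-1%g (hi i) ->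
  #|inversions (refl i ** s)| = #|inversions s|.+1.
Proof.
move=> asc; rewrite inversions_asc // cardsU1 inE /= !permKV asc /=.
by rewrite ltnNge leqnSn.
Qed.

Lemma card_inversions_desc i s : s^-1%g (hi i) < s^-1%g (lo i) ->
  #|inversions s| = #|inversions (refl i ** s)|.+1.
Proof.
move=> desc; rewrite -{1}(refl_comppK i s) card_inversions_asc //.
by rewrite /compp invMg !permM /refl tpermV tpermL tpermR.
Qed.

Lemma lo_hi_cases i s :
  {s^-1%g (lo i) < s^-1%g (hi i)} + {s^-1%g (hi i) < s^-1%g (lo i)}.
Proof.
case: (ltngtP (s^-1%g (lo i)) (s^-1%g (hi i))) => [||/val_inj/perm_inj/(congr1 val)/=];
  by [left|right|lia].
Qed.

Lemma card_inversions_word w : #|inversions (word_prod w)| <= size w.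
Proof.
elim: w => [|i w IHw] /=.
  rewrite leqn0 cards_eq0; apply/eqP/setP => -[x y]; rewrite !inE !perm1 /=.
  by case: ltngtP.
case: (lo_hi_cases i (word_prod w)) => h.
  by rewrite card_inversions_asc.
by rewrite (card_inversions_desc h) in IHw; apply: leqW; apply: ltnW.
Qed.

(** Induction on the number of inversions: a descent can be stripped off on the left, and without
    descents [s^-1] is increasing, so [s] is the identity. *)
Lemma ex_reduced_word s :
  exists2 w, size w = #|inversions s| & word_prod w = s.
Proof.
move: {2}#|inversions s| (erefl #|inversions s|) => k.
elim: k s => [|k IHk] s ks.
  exists [::]; rewrite ?ks //=; apply/esym.
  rewrite -[s]invgK (@lt_all_eq1 s^-1) ?invg1 // => i.
  by case: (lo_hi_cases i s) => // /card_inversions_desc; rewrite ks.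
have [i di] : exists i, s^-1%g (hi i) < s^-1%g (lo i).
  have [/existsP //|] := boolP [exists i, s^-1%g (hi i) < s^-1%g (lo i)].
  rewrite negb_exists => /forallP nd.
  suff s1 : s = 1%g by have := card_inversions_word [::]; rewrite /= -s1 ks.
  rewrite -[s]invgK (@lt_all_eq1 s^-1) ?invg1 // => i.
  by case: (lo_hi_cases i s) (nd i) => // ->.
have [w wk ws] : exists2 w, size w = #|inversions (refl i ** s)|
    & word_prod w = refl i ** s.
  by apply: IHk; have := card_inversions_desc di; lia.
exists (i :: w); last by rewrite /= ws refl_comppK.
by rewrite /= wk (card_inversions_desc di).
Qed.

Lemma len_inversions s : len s = #|inversions s|.
Proof.
rewrite /len; case: ex_minnP => k /has_wordP[w <- ws] kmin.
apply/eqP; rewrite eqn_leq -{2}ws card_inversions_word andbT.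
by apply: kmin; apply/has_wordP; exact: ex_reduced_word.
Qed.

Lemma mem_DesL i s : (i \in DesL s) = (s^-1%g (hi i) < s^-1%g (lo i)).
Proof.
rewrite inE !len_inversions; case: (lo_hi_cases i s) => h.
  by rewrite card_inversions_asc // [RHS]ltnNge (ltnW h) ltnNge leqnSn.
by rewrite h (card_inversions_desc h) ltnSn.
Qed.

Lemma mem_DesLN i s : (i \notin DesL s) = (s^-1%g (lo i) < s^-1%g (hi i)).
Proof.
rewrite mem_DesL -perm_lt_neq //; apply/eqP => /(congr1 val) /=; lia.
Qed.

Lemma inversionsV s x y :
  (x, y) \in inversions s^-1%g = ((s^-1%g y, s^-1%g x) \in inversions s).
Proof. by rewrite !inE /= !permKV andbC. Qed.

(** Inverting exchanges positions and values, hence keeps the length; this is what carries the right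
    order over to the left order. *)
Lemma card_inversionsV s : #|inversions s^-1%g| = #|inversions s|.
Proof.
pose f (p : 'I_n * 'I_n) := (s^-1%g p.2, s^-1%g p.1).
have fI : injective f by move=> [a b] [c d] [/perm_inj-> /perm_inj->].
rewrite -[RHS](on_card_preimset (f := f)); last first.
  exists (fun p => (s p.2, s p.1)) => -[a b] _; rewrite /f /= ?permKV ?permK //.
by apply: eq_card => -[x y]; rewrite [RHS]inE inversionsV.
Qed.

Lemma reflV i : (refl i)^-1%g = refl i.
Proof. by rewrite /refl tpermV. Qed.

Lemma comppV s t : (s ** t)^-1%g = t^-1%g ** s^-1%g.
Proof. by rewrite /compp invMg. Qed.

Lemma DesR_V s : DesR s = DesL s^-1%g.
Proof.
apply/setP => i; rewrite !inE !len_inversions -card_inversionsV.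
by rewrite comppV reflV card_inversionsV.
Qed.

Lemma coverR_V s t : coverR s t = coverL s^-1%g t^-1%g.
Proof.
rewrite /coverR /coverL DesR_V; apply: eq_existsb => i; congr (_ && _).
by rewrite -(inj_eq invg_inj) comppV reflV.
Qed.

Lemma coverLP s t :
  reflect (exists2 i, i \notin DesL s & t = refl i ** s) (coverL s t).
Proof.
apply: (iffP existsP) => [[i /andP[? /eqP ?]]|[i ? ->]]; exists i => //.
by rewrite eqxx andbT.
Qed.

Lemma inversions_inj : injective inversions.
Proof.
move=> s t est.
apply: perm_eq_order => x y; case: (ltngtP x y) => [xy|yx|/val_inj->].
- have /setP/(_ (x, y)) := est; rewrite !inE /= xy /=.
  by rewrite ![s x < _]perm_lt_neq ?[t x < _]perm_lt_neq;
    do ?[move=> ->] => //; apply: contraTneq xy => ->; rewrite ltnn.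
- by have /setP/(_ (y, x)) := est; rewrite !inE /= yx.
- by rewrite !ltnn.
Qed.

(* If [s] is strictly below [t], some ascent of [s] is reversed in [t], since
   otherwise [t ** s^-1] is increasing. *)
Lemma leL_sub s t : leL s t = (inversions s \subset inversions t).
Proof.
apply/idP/idP => [/connectP[p + ->]|].
  elim: p s => [|u p IHp] s //= /andP[/coverLP[i + ->] /IHp].
  by rewrite mem_DesLN => /inversions_asc -> /subUsetP[].
move: {2}(#|inversions t| - #|inversions s|)
  (erefl (#|inversions t| - #|inversions s|)) => k.
elim: k s => [|k IHk] s ks st.
  have /eqP/inversions_inj-> : inversions s == inversions t.
    by rewrite eqEcard st; move: ks; lia.
  exact: connect0.
have [i asc rev] : exists2 i, i \notin DesL s &
    t (s^-1%g (hi i)) < t (s^-1%g (lo i)).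
  have [/existsP[i /andP[? ?]]|] := boolP [exists i, (i \notin DesL s) &&
    (t (s^-1%g (hi i)) < t (s^-1%g (lo i)))]; first by exists i.
  rewrite negb_exists => /forallP nd.
  suff e : (s^-1 * t = 1)%g.
    by move: ks; rewrite -[t](mulKVg s) e mulg1 subnn.
  apply: lt_all_eq1 => i; rewrite !permM.
  have := nd i; rewrite mem_DesLN.
  case: (lo_hi_cases i s) => h.
    rewrite h /= -perm_lt_neq //.
    by rewrite (inj_eq perm_inj) -val_eqE /=; lia.
  move=> _; have /subsetP/(_ (s^-1%g (hi i), s^-1%g (lo i))) := st.
  by rewrite !inE /= !permKV h /= ltnSn => /(_ isT).
have asc' := asc; rewrite mem_DesLN in asc'.
apply: connect_trans (connect1 _) (IHk (refl i ** s) _ _).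
- by apply/coverLP; exists i.
- by rewrite card_inversions_asc //; lia.
- by rewrite inversions_asc // subUset sub1set st inE /= asc' rev.
Qed.

Lemma leLP s t :
  reflect (forall x y, x < y -> s y < s x -> t y < t x) (leL s t).
Proof.
rewrite leL_sub; apply: (iffP subsetP) => [st x y xy sxy|st [x y]].
  by have := st (x, y); rewrite !inE /= xy sxy /= => /(_ isT).
by rewrite !inE => /= /andP[xy /(st _ _ xy)->]; rewrite xy.
Qed.

Lemma leR_V s t : leR s t = leL s^-1%g t^-1%g.
Proof.
have E u v : coverR u v = relpre (fun w : 'S_n => w^-1%g) (@coverL n) u v.
  by rewrite coverR_V.
apply/connectP/connectP => -[p].
  move=> ep ->; exists (map (fun w : 'S_n => w^-1%g) p).
    by rewrite path_map; apply: sub_path ep => u v; rewrite E.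
  by rewrite last_map.
move=> ep et; exists (map (fun w : 'S_n => w^-1%g) p).
  rewrite (eq_path E) -path_map mapK ?invgK //; exact: invgK.
by apply: invg_inj; rewrite et -{2}[s]invgK last_map invgK.
Qed.

End WeakOrder.

(** * Covers in the left order, and intervals as sets of linear extensions *)

Section LeftOrder.

Variable n : nat.
Implicit Types (i j : 'I_n.-1) (s t r g : 'S_n) (x y z : 'I_n).

Lemma leL_card s t : leL s t -> #|inversions t| <= #|inversions s| -> s = t.
Proof.
by rewrite leL_sub => st ts; apply/inversions_inj/eqP; rewrite eqEcard st.
Qed.

Lemma leL_anti s t : leL s t -> leL t s -> s = t.
Proof.
by move=> st; rewrite leL_sub => /subset_leq_card; apply: leL_card.
Qed.

Lemma leL_trans : transitive (@leL n).
Proof. by move=> s t r; apply: connect_trans. Qed.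

Lemma leL_refl : reflexive (@leL n).
Proof. by move=> s; apply: connect0. Qed.

Lemma leL_cover_cases s t i : i \notin DesL s ->
  leL s t -> leL t (refl i ** s) -> t = s \/ t = refl i ** s.
Proof.
move=> asc st ts; rewrite mem_DesLN in asc.
have := card_inversions_asc asc => e.
have [h|h] := leqP #|inversions t| #|inversions s|.
  by left; apply/esym/leL_card.
by right; apply: leL_card => //; rewrite e.
Qed.

Lemma leL_first s t : leL s t -> s <> t ->
  exists2 i, i \notin DesL s & leL (refl i ** s) t.
Proof.
move=> /connectP[[|u p] /=]; first by move=> _ ->.
move=> /andP[/coverLP[i ? ->] ?] -> _; exists i => //.
by apply/connectP; exists p.
Qed.

Lemma leL_last s t : leL s t -> s <> t ->
  exists u i, [/\ leL s u, i \notin DesL u & t = refl i ** u].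
Proof.
move=> /connectP[p]; elim/last_ind: p => [|p u _]; first by move=> _ /= ->.
rewrite rcons_path last_rcons => /andP[sp /coverLP[i iP ->]] -> _.
by exists (last s p), i; split => //; apply/connectP; exists p.
Qed.

Lemma leL_asc s i : i \notin DesL s -> leL s (refl i ** s).
Proof. by move=> iP; apply/connect1/coverLP; exists i. Qed.

(** If [j] is next to [i], the two ascents put three consecutive values in increasing positions, and
    swapping the pair at [i] keeps the pair at [j] increasing. If [j] is farther away, its pair does
    not move. *)
Lemma DesL_asc s i j : i \notin DesL s -> j \notin DesL s ->
  j \in DesL (refl i ** s) -> j = i.
Proof.
rewrite !mem_DesLN mem_DesL comppV reflV !comppE => asci ascj.
have [//|/negP ji desc] := eqVneq j i; exfalso.
have nlo : lo i != lo j.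
  by apply/eqP => /(congr1 val) /= e; apply: ji; rewrite -val_eqE /= e.
have nhi : hi i != hi j.
  by apply/eqP => /(congr1 val) /= [e]; apply: ji; rewrite -val_eqE /= e.
move: desc; rewrite /refl.
have [e|n1] := eqVneq (hi i) (lo j).
  by rewrite -e tpermR tpermD // -?val_eqE /=; move: ascj; rewrite -?e /=;
    have := congr1 val e => /=; lia.
have [e|n2] := eqVneq (lo i) (hi j).
  by rewrite -e tpermL tpermD // 1?eq_sym //; move: ascj; rewrite -?e /=; lia.
by rewrite !tpermD //; lia.
Qed.

(** The poset on positions whose linear extensions form the interval from [s] to [r], see
    [mem_intervalL]. *)
Definition ltI s r : rel 'I_n := fun x y => (s x < s y) && (r x < r y).

Lemma ltI_irr s r x : ltI s r x x = false.
Proof. by rewrite /ltI ltnn. Qed.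

Lemma ltI_trans s r : transitive (ltI s r).
Proof. by move=> y x z; rewrite /ltI; lia. Qed.

Lemma ltn_val_perm s x y : s x < s y -> x != y.
Proof. by apply: contraTneq => ->; rewrite ltnn. Qed.

(** As [s] lies below [r], a pair where [g] loses an inversion of [s], or has one absent from [r],
    is a pair on which [s] and [r] agree. *)
Lemma mem_intervalL s r g : leL s r ->
  reflect (forall x y, ltI s r x y -> g x < g y) (g \in intervalL s r).
Proof.
move=> /leLP sr; rewrite inE; apply: (iffP andP).
  move=> [/leLP sg /leLP gr] x y /andP[sxy rxy].
  rewrite perm_lt_neq ?(ltn_val_perm sxy) //; apply/negP => gyx.
  case: (ltngtP x y) => [xy|yx|/val_inj xy].
  - by have := gr _ _ xy gyx; lia.
  - by have := sg _ _ yx sxy; lia.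
  - by move: sxy; rewrite xy ltnn.
move=> gP; split; apply/leLP => x y xy.
  by move=> syx; apply: gP; rewrite /ltI syx sr.
move=> gyx; rewrite perm_lt_neq -?val_eqE /=; last by lia.
apply/negP => rxy; suff /gP : ltI s r x y by lia.
rewrite /ltI rxy andbT perm_lt_neq -?val_eqE /=; last by lia.
by apply/negP => /(sr _ _ xy); lia.
Qed.

Lemma intervalL_nonempty s r : leL s r -> intervalL s r != set0.
Proof. by move=> sr; apply/set0Pn; exists s; rewrite inE leL_refl. Qed.

Lemma intervalL_inv s r : intervalL s r != set0 -> leL s r.
Proof. by case/set0Pn => g; rewrite inE => /andP[]; apply: leL_trans. Qed.

End LeftOrder.

(** * Relabellings of the poset of an interval, and the order on its class *)

Section Classes.

Variable n : nat.
Implicit Types (i j : 'I_n.-1) (s t r g phi psi : 'S_n) (x y z : 'I_n).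
Implicit Types (Q : rel 'I_n).

(** For distinct elements of a strict order: incomparable, or one covers the other. For [ltI s r]
    these are the pairs that become adjacent in some linear extension. *)
Definition nb Q x y := forall z, ~ (Q x z && Q z y) /\ ~ (Q y z && Q z x).

Definition compat Q phi := forall x y, nb Q x y -> (phi x < phi y) = (x < y).

Definition le_compat Q phi psi :=
  forall x y, Q x y -> phi y < phi x -> psi y < psi x.

Lemma nb_sym Q x y : nb Q x y -> nb Q y x.
Proof. by move=> xy z; have [] := xy z. Qed.

Lemma nb_ltI s r x y : s x < s y -> r y < r x -> nb (ltI s r) x y.
Proof. by move=> sxy ryx z; rewrite /ltI; lia. Qed.

Lemma incomp_cases s r x y : x != y -> ~~ ltI s r x y -> ~~ ltI s r y x ->
  nb (ltI s r) x y.
Proof.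
move=> xy; rewrite /ltI (perm_lt_neq s xy) (perm_lt_neq r xy).
case: (boolP (s y < s x)); case: (boolP (r y < r x)) => //= h1 h2 _ _.
  by apply/nb_sym/nb_ltI => //; rewrite perm_lt_neq.
by apply/nb_ltI => //; rewrite perm_lt_neq.
Qed.

(* Take first what lies below [x] or [y] in the poset, then [x], [y], then the
   rest, each part in the order of [s]. *)
Lemma adjacent_extension s r x y : leL s r -> s x < s y -> nb (ltI s r) x y ->
  exists2 g, g \in intervalL s r & g y = (g x).+1 :> nat.
Proof.
move=> sr sxy xyN; pose Q := ltI s r.
pose cls z := if (z == x) || (z == y) then 1 else if Q z x || Q z y then 0 else 2.
pose k z := cls z * n + s z.
have kcls u v : k u < k v -> cls u <= cls v.
  rewrite /k; have := ltn_ord (s u); have := ltn_ord (s v).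
  by rewrite leqNgt => *; apply/negP => ?; nia.
have kI : injective k.
  move=> u v e; apply: (@perm_inj _ s); apply: val_inj => /=; move: e; rewrite /k.
  have := ltn_ord (s u); have := ltn_ord (s v).
  have [->|] := eqVneq (cls u) (cls v); first by lia.
  rewrite neq_ltn => /orP[] *; nia.
have [g gP] := perm_of_order kI; exists g.
  apply/mem_intervalL => // u v uv; rewrite gP /k.
  suff uvc : cls u <= cls v by case/andP: uv => *; nia.
  rewrite /cls; case: ifP => [/orP uxy|uxy].
    case: ifP => // /norP[vx vy]; case: ifP => // /orP vxy.
    move: uv (xyN v); rewrite -/Q; case: uxy => /eqP ->; case: vxy => h uv [n1 n2].
    - by have := ltI_trans uv h; rewrite ltI_irr.
    - by case: n1; apply/andP.
    - by case: n2; apply/andP.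
    - by have := ltI_trans uv h; rewrite ltI_irr.
  have below w : Q v w -> Q u w by apply: ltI_trans.
  case: (boolP ((v == x) || (v == y))) => [/orP[]/eqP ve|_]; first by rewrite -ve [Q u v]uv.
    by rewrite -ve [Q u v]uv orbT.
  case: (boolP (Q v x)) => [/below->//|_].
  by case: (boolP (Q v y)) => [/below->|_]; rewrite ?orbT //; case: ifP.
have cx : cls x = 1 by rewrite /cls eqxx.
have cy : cls y = 1 by rewrite /cls eqxx orbT.
have gxy : g x < g y by rewrite gP /k cx cy; lia.
(* An entry strictly between [x] and [y] would have class 1, as [g] sorts by class first, and so
   would be [x] or [y]. *)
apply/eqP; rewrite eqn_leq gxy andbT leqNgt; apply/negP => gap.
have wn : (g x).+1 < n by have := ltn_ord (g y); lia.
pose w := g^-1%g (Ordinal wn).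
have gw : g w = (g x).+1 :> nat by rewrite /w permKV.
have xw : g x < g w by rewrite gw.
have wy : g w < g y by rewrite gw.
have : cls w = 1.
  rewrite gP in xw; rewrite gP in wy; have := kcls _ _ xw; have := kcls _ _ wy.
  by rewrite cx cy; lia.
rewrite /cls; case: ifP => [|_]; last by case: ifP.
by move=> /orP[] /eqP e _; move: xw wy; rewrite e ltnn.
Qed.

Lemma mem_shift s r phi g : leL s r -> leL (s ** phi^-1%g) (r ** phi^-1%g) ->
  (g \in intervalL (s ** phi^-1%g) (r ** phi^-1%g)) = (g ** phi \in intervalL s r).
Proof.
move=> sr sr'; apply/mem_intervalL/mem_intervalL => // gP x y xy.
  by rewrite !comppE; apply: gP; rewrite /ltI !comppE !permK.
have := gP (phi^-1%g x) (phi^-1%g y); rewrite !comppE !permKV; apply.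
by move: xy; rewrite /ltI !comppE.
Qed.

(** A pair ordered oppositely by [s] and [r] is incomparable in [ltI s r], so [phi] keeps the order
    of its labels. *)
Lemma compat_leL s r phi : leL s r -> compat (ltI s r) phi ->
  leL (s ** phi^-1%g) (r ** phi^-1%g).
Proof.
move=> /leLP sr pC; apply/leLP => a b ab; rewrite !comppE => sba.
rewrite perm_lt_neq; last by rewrite (inj_eq perm_inj) -val_eqE /=; lia.
apply/negP => rab; have := pC _ _ (nb_ltI sba rab); rewrite !permKV.
rewrite ltnNge (ltnW ab) /= => /esym/negbT; rewrite -leqNgt leq_eqVlt.
move=> /orP[/eqP/val_inj/perm_inj e|ba]; first by move: ab; rewrite e ltnn.
by have := sr _ _ ba sba; lia.
Qed.

Lemma nb_interval s r g x y : leL s r -> g \in intervalL s r ->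
  g y = (g x).+1 :> nat -> nb (ltI s r) x y.
Proof.
move=> sr /(mem_intervalL _ sr) gP gxy z; split; case/andP => /gP + /gP; lia.
Qed.

Lemma nb_reversed s r g h x y : leL s r -> g \in intervalL s r ->
  h \in intervalL s r -> g x < g y -> h y < h x -> nb (ltI s r) x y.
Proof.
move=> sr /(mem_intervalL _ sr) gP /(mem_intervalL _ sr) hP gxy hyx.
apply: incomp_cases; first exact: ltn_val_perm gxy.
  by apply/negP => /hP; lia.
by apply/negP => /gP; lia.
Qed.

(** The isomorphism is right multiplication by [phi]. Two members of the interval disagree only on
    incomparable pairs, and consecutive values sit at an [nb] pair; [phi] keeps the label order of
    both, hence the left order and the descent sets. *)
Lemma classD_shift s r phi : leL s r -> compat (ltI s r) phi ->
  classD (intervalL s r) (intervalL (s ** phi^-1%g) (r ** phi^-1%g)).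
Proof.
move=> sr pC; have sr' := compat_leL sr pC; split.
  rewrite inE intervalL_nonempty //=; apply/existsP; exists (s ** phi^-1%g).
  by apply/existsP; exists (r ** phi^-1%g).
exists (fun g => g ** phi); split.
- by move=> g h _ _ /(congr1 (fun u => u ** phi^-1%g)); rewrite !comppK.
- apply/setP => g; apply/imsetP/idP => [[h + ->]|gI]; first by rewrite mem_shift.
  by exists (g ** phi^-1%g); rewrite ?mem_shift ?comppKV.
- move=> g h; rewrite !mem_shift // => gI hI; apply/leLP/leLP => gh a b ab.
    move=> gba; rewrite perm_lt_neq -?val_eqE /=; last by lia.
    apply/negP => hab.
    have /pC : nb (ltI s r) (phi^-1%g b) (phi^-1%g a).
      by apply: (nb_reversed sr gI hI); rewrite !comppE !permKV.
    rewrite !permKV ltnNge (ltnW ab) /= => /esym/negbT; rewrite -leqNgt leq_eqVlt.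
    move=> /orP[/eqP/val_inj/perm_inj e|ba]; first by move: ab; rewrite e ltnn.
    by have := gh _ _ ba; rewrite !comppE !permKV => /(_ gba); lia.
  rewrite !comppE => gba.
  rewrite perm_lt_neq; last by rewrite (inj_eq perm_inj) -val_eqE /=; lia.
  apply/negP => hab.
  have /pC : nb (ltI s r) b a.
    by apply: (nb_reversed (g := g ** phi) (h := h ** phi)); rewrite ?comppE.
  rewrite [RHS]ltnNge (ltnW ab) /= => /negbT; rewrite -leqNgt leq_eqVlt.
  move=> /orP[/eqP/val_inj/perm_inj e|ba]; first by move: ab; rewrite e ltnn.
  by have := gh _ _ ba gba; lia.
- move=> g; rewrite mem_shift // => gI; apply/setP => i.
  rewrite !mem_DesL comppV !comppE.
  set x := _ (lo i); set y := _ (hi i).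
  have gy : g y = (g x).+1 :> nat by rewrite /x /y !permKV.
  have -> : x = phi (phi^-1%g x) by rewrite permKV.
  have -> : y = phi (phi^-1%g y) by rewrite permKV.
  rewrite !permK; apply/esym/pC/nb_sym/(nb_interval sr gI).
  by rewrite !comppE !permKV.
Qed.

(* Adding [i] to the descent set is the only change that can enlarge it along
   the cover [u -> refl i ** u], so [f] commutes with covers. *)
Lemma simD_shift s r s' r' : leL s r -> leL s' r' ->
  simD (intervalL s' r') (intervalL s r) ->
  exists phi, [/\ compat (ltI s r) phi, s' = s ** phi^-1%g & r' = r ** phi^-1%g].
Proof.
move=> sr sr' [f [fI fE fle fD]].
have fim g : g \in intervalL s' r' -> f g \in intervalL s r.
  by move=> gI; rewrite -fE; apply: imset_f.
have s'I : s' \in intervalL s' r' by rewrite inE leL_refl.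
have r'I : r' \in intervalL s' r' by rewrite inE leL_refl sr'.
have lows : forall g, g \in intervalL s r -> exists2 h, h \in intervalL s' r' & g = f h.
  by move=> g; rewrite -fE => /imsetP.
have fs : f s' = s.
  have [|h hI e] := lows s; first by rewrite inE leL_refl.
  apply: leL_anti; last by have := fim _ s'I; rewrite inE => /andP[].
  by rewrite e fle //; move: hI; rewrite inE => /andP[].
have fr : f r' = r.
  have [|h hI e] := lows r; first by rewrite inE leL_refl sr.
  apply: leL_anti; first by have := fim _ r'I; rewrite inE => /andP[].
  by rewrite e fle //; move: hI; rewrite inE => /andP[].
pose phi := s'^-1%g ** s.
(* Since [f] maps lower end to lower end, [phi] is the only possible translation. *)
have fphi g : g \in intervalL s' r' -> f g = g ** phi.
  move: {2}#|inversions g| (erefl #|inversions g|) => k.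
  elim: k g => [|k IHk] g gk gI.
    have -> : g = s'.
      by apply/esym/leL_card; rewrite ?gk //; move: gI; rewrite inE => /andP[].
    by rewrite fs /phi comppA /compp mulVg mulg1.
  have [->|/eqP gs] := eqVneq g s'; first by rewrite fs /phi comppA /compp mulVg mulg1.
  have [sg gr] : leL s' g /\ leL g r' by move: gI; rewrite inE => /andP[].
  have [u [i [su iP gE]]] := leL_last sg (nesym gs).
  have ug : leL u g by rewrite gE leL_asc.
  have uI : u \in intervalL s' r' by rewrite inE su (leL_trans ug).
  have uk : #|inversions u| = k.
    by have := iP; rewrite mem_DesLN => /card_inversions_asc; rewrite -gE gk => -[].
  have fug : f u <> f g.
    by move=> /fI -/(_ uI gI) e; move: uk; rewrite e gk => /eqP; rewrite eqn_leq ltnn.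
  have lefug : leL (f u) (f g) by rewrite fle.
  (* The first cover above [f u] on the way to [f g] is the image of an element between [u] and [g],
     other than [u], hence of [g]. *)
  have [j jP jle] := leL_first lefug fug.
  have hI : refl j ** f u \in intervalL s r.
    have := fim _ uI; have := fim _ gI; rewrite !inE => /andP[_ h1] /andP[h2 _].
    by rewrite (leL_trans h2 (leL_asc jP)) (leL_trans jle).
  have [h h'I hE] := lows _ hI.
  have hcase : h = u \/ h = g.
    rewrite gE; apply: leL_cover_cases => //.
      by rewrite -fle // -hE leL_asc.
    by rewrite -gE -fle // -hE.
  have {hcase} hg : h = g.
    case: hcase => // hu; move: hE; rewrite hu => e.
    have := jP; rewrite mem_DesLN => /card_inversions_asc; rewrite e => /eqP.
    by rewrite eqn_leq ltnn andbF.
  have ji : j = i.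
    apply: (DesL_asc iP); first by rewrite -(fD u).
    rewrite -gE -(fD g) // -hg -hE mem_DesL comppV !comppE reflV /refl tpermL tpermR.
    by rewrite -mem_DesLN.
  by rewrite -{1}hg -hE (IHk u) // ji comppA -gE.
have sE : s = s' ** phi by rewrite -fs fphi.
have rE : r = r' ** phi by rewrite -fr fphi.
exists phi; split; [|by rewrite sE comppK|by rewrite rE comppK].
(* The pair is adjacent in some member [g] of the interval. The descent there compares [x] and [y]
   for [g], and their labels under [phi] for the preimage of [g]. *)
suff main x y : s x < s y -> nb (ltI s r) x y -> (phi y < phi x) = (y < x).
  move=> x y; have [->|xy] := eqVneq x y; first by rewrite !ltnn.
  case: (ltngtP (s x) (s y)) => [sxy|syx|/val_inj/perm_inj e] xyN.
  - have := main _ _ sxy xyN; rewrite [phi x < _]perm_lt_neq // => ->.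
    by have := perm_lt_neq 1%g xy; rewrite !perm1.
  - exact/main/nb_sym.
  - by rewrite e eqxx in xy.
move=> sxy xyN; have [g gI gxy] := adjacent_extension sr sxy xyN.
have [h hI gE] := lows g gI; have [i [lox hiy]] := ex_lo gxy.
have := fD h hI; rewrite -gE => /setP/(_ i); rewrite !mem_DesL.
have -> : h = g ** phi^-1%g by rewrite gE fphi // comppK.
by rewrite comppV invgK !comppE lox hiy !permK.
Qed.

(** After inversion, the right order asks that pairs with [s x < s y] reversed by [phi] be reversed
    by [psi]. Compatibility fixes the labels of those that [r] inverts, so only pairs of [ltI s r]
    matter. *)
Lemma leR_shift s r phi psi : leL s r ->
  compat (ltI s r) phi -> compat (ltI s r) psi ->
  leR (s ** phi^-1%g) (s ** psi^-1%g) <-> le_compat (ltI s r) phi psi.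
Proof.
move=> sr phiC psiC; rewrite leR_V !comppV !invgK; split.
  move=> /leLP le x y /andP[sxy _] yx.
  by have := le _ _ sxy; rewrite !comppE !permK; apply.
move=> le; apply/leLP => u v uv; rewrite !comppE.
set x := _ u; set y := _ v => yx.
have sxy : s x < s y by rewrite /x /y !permKV.
have [rxy|ryx|/val_inj/perm_inj e] := ltngtP (r x) (r y).
- by apply: le => //; rewrite /ltI sxy.
- by rewrite psiC -1?phiC //; apply/nb_sym/nb_ltI.
- by move: sxy; rewrite e ltnn.
Qed.

Lemma classD_inv s r J : leL s r -> classD (intervalL s r) J ->
  exists phi, compat (ltI s r) phi /\ J = intervalL (s ** phi^-1%g) (r ** phi^-1%g).
Proof.
move=> sr []; rewrite inE => /andP[J0 /existsP[s' /existsP[r' /eqP JE]]].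
rewrite JE => /simD_shift => /(_ sr) [|phi [phiC -> ->]]; last by exists phi.
by apply: intervalL_inv; rewrite -JE.
Qed.

Lemma le_class_shift s r phi psi : leL s r ->
  compat (ltI s r) phi -> compat (ltI s r) psi -> le_compat (ltI s r) phi psi ->
  le_class (intervalL (s ** phi^-1%g) (r ** phi^-1%g))
           (intervalL (s ** psi^-1%g) (r ** psi^-1%g)).
Proof.
move=> sr phiC psiC le; exists (s ** phi^-1%g), (r ** phi^-1%g).
exists (s ** psi^-1%g), (r ** psi^-1%g); split=> //; try exact: compat_leL.
by apply/(leR_shift sr phiC psiC).
Qed.

Lemma is_max_class_compat s r phi : leL s r -> compat (ltI s r) phi ->
  (forall psi, compat (ltI s r) psi -> le_compat (ltI s r) psi phi) ->
  is_max_class (classD (intervalL s r))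
    (intervalL (s ** phi^-1%g) (r ** phi^-1%g)).
Proof.
move=> sr phiC max; split; first exact: classD_shift.
by move=> J /classD_inv[] // psi [psiC ->]; apply: le_class_shift => //; apply: max.
Qed.

Lemma is_min_class_compat s r phi : leL s r -> compat (ltI s r) phi ->
  (forall psi, compat (ltI s r) psi -> le_compat (ltI s r) phi psi) ->
  is_min_class (classD (intervalL s r))
    (intervalL (s ** phi^-1%g) (r ** phi^-1%g)).
Proof.
move=> sr phiC min; split; first exact: classD_shift.
by move=> J /classD_inv[] // psi [psiC ->]; apply: le_class_shift => //; apply: min.
Qed.

End Classes.

(** * Chains of forced relations and the greedy relabelling *)

Section Greedy.

Variables (n : nat) (Q : rel 'I_n).
Hypothesis Qirr : irreflexive Q.
Hypothesis Qtrans : transitive Q.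
Implicit Types (x y z p q m : 'I_n) (phi psi : 'S_n).

Definition step x y := x < y /\ nb Q x y.

Inductive chain x y : Prop :=
| chain_step of step x y
| chain_cons z of step x z & chain z y.

Lemma chain_trans x y z : chain x y -> chain y z -> chain x z.
Proof.
elim=> [a b ab|a b c ac _ IH] bz; first exact: chain_cons ab bz.
exact: chain_cons ac (IH bz).
Qed.

Lemma chain_last x y : chain x y ->
  step x y \/ exists2 z, chain x z & step z y.
Proof.
elim=> [a b ab|a b c ac _ [cb|[z cz zb]]]; first by left.
  by right; exists c => //; apply: chain_step.
by right; exists z => //; apply: chain_cons ac cz.
Qed.

Lemma chain_lt phi x y : compat Q phi -> chain x y -> phi x < phi y.
Proof.
move=> phiC; elim=> [a b [ab /phiC->] //|a b c [ac /phiC acN] _].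
by apply: ltn_trans; rewrite acN.
Qed.

Lemma incomp_nb x y : ~~ Q x y -> ~~ Q y x -> nb Q x y.
Proof.
move=> /negP xy /negP yx z; split=> /andP[a b]; first exact: xy (Qtrans a b).
exact: yx (Qtrans a b).
Qed.

(* A chain from below [m] to above [m] visits [m] or an element incomparable
   to [m]: a step from below to above would have [m] strictly in between. *)
Lemma chain_through x m y : Q x m -> Q m y -> chain x y ->
  chain x m \/ chain m y.
Proof.
move=> + + xy; elim: xy => {x y} [x y [_ xyN]|x y z xz zy IH] xm my.
  by have [] := xyN m; rewrite xm my.
have [zm|zmN] := boolP (Q z m).
  by have [zm'|] := IH zm my; [left; apply: chain_cons zm' | right].
have [mz|mzN] := boolP (Q m z).
  by case: xz => _ /(_ m)[]; rewrite xm mz.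
have zmC := incomp_nb zmN mzN; case: (ltngtP z m) => [lt|gt|/val_inj e].
- by left; apply: chain_cons xz _; apply: chain_step.
- by right; apply: chain_cons zy; split => //; apply: nb_sym.
- by right; rewrite -e.
Qed.

(* Entries below [k] are placed for good, the other ones are still sorted. *)
Record greedy_inv (k : nat) phi : Prop := GreedyInv {
  greedy_compat : compat Q phi;
  greedy_sorted : forall x y, k <= phi x -> k <= phi y ->
    (phi x < phi y) = (x < y);
  greedy_chain : forall x y, phi x < k -> phi x < phi y -> chain x y \/ Q y x
}.

Definition source k phi x := k <= phi x /\ forall q, k <= phi q -> ~ step q x.

Lemma greedy_inv0 : greedy_inv 0 1%g.
Proof. by split=> x y; rewrite ?perm1. Qed.

(** Going down along steps between unplaced entries decreases [phi], so the descent ends at a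
    source. *)
Lemma ex_source k phi y : compat Q phi -> k <= phi y ->
  exists2 x, source k phi x & x = y \/ chain x y.
Proof.
move=> phiC; move: {2}(phi y : nat) (erefl (phi y : nat)) => N.
elim/ltn_ind: N y => N IHN y yN ky.
(* The relation [step q y] is spelled out as a boolean so that the existence of [q] can be
   decided. *)
have [/existsP[q /andP[kq /forallP h]]|] := boolP [exists q, (k <= phi q) &&
    [forall z, [&& q < y, ~~ (Q q z && Q z y) & ~~ (Q y z && Q z q)]]].
  have qy : step q y.
    split; first by case/and3P: (h q).
    by move=> z; case/and3P: (h z) => _ /negP ? /negP.
  have [|//|x xs xq] := IHN (phi q) _ q (erefl _).
    by rewrite -yN (chain_lt phiC) //; apply: chain_step.
  exists x => //; right; case: xq => [->|xq]; first exact: chain_step.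
  by apply: chain_trans xq _; apply: chain_step.
rewrite negb_exists => /forallP h; exists y; last by left.
split=> // q kq [qy qyN]; have := h q; rewrite kq /= => /forallP; apply=> z.
by have [h1 h2] := qyN z; rewrite qy /=; apply/andP; split; apply/negP.
Qed.

(** The last step of such a chain would start at [p] or at an entry with a larger label, hence at an
    unplaced one. *)
Lemma source_chain k phi p x : compat Q phi -> source k phi x ->
  k <= phi p -> ~ chain p x.
Proof.
move=> phiC [_ xs] kp /chain_last[/(xs _ kp)//|[z /(chain_lt phiC) pz]].
by apply: xs; apply: ltnW (leq_ltn_trans kp pz).
Qed.

Definition promote (i x v : nat) : nat :=
  if v == x then i else if i <= v < x then v.+1 else v.

Lemma ex_promote phi (i x : 'I_n) : i <= x ->
  exists psi : 'S_n, forall p, psi p = promote i x (phi p) :> nat.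
Proof.
move=> ix; have lt v : promote i x (v : 'I_n) < n.
  rewrite /promote; have := ltn_ord v; have := ltn_ord x; have := ltn_ord i.
  by (do 2?case: ifP); lia.
have fI : injective (fun v => Ordinal (lt v)).
  move=> u v [] e; apply: val_inj => /=; move: e; rewrite /promote.
  by (do 4? case: ifP); lia.
by exists (phi * perm fI)%g => p; rewrite permM permE.
Qed.

(** As [m] is a source, moving it forward breaks no constraint. As every other source is [Q]-below
    [m], an entry left behind [m] is either reached from [m] by a chain or [Q]-below [m]. *)
Lemma greedy_inv_step k phi psi m : greedy_inv k phi -> source k phi m ->
  (forall x, source k phi x -> x != m -> Q x m) ->
  (forall p, psi p = promote k (phi m) (phi p) :> nat) ->
  greedy_inv k.+1 psi.
Proof.
move=> [phiC phiS phiK] ms mtop psiE; have [km mmin] := ms.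
have psim : psi m = k :> nat by rewrite psiE /promote eqxx.
have eqm x : (phi x == phi m :> nat) = (x == m).
  by rewrite (inj_eq val_inj) (inj_eq perm_inj).
(* An overtaken entry forming an [nb] pair with [m] would give a step into the source [m]. *)
have moved p : phi p < phi m -> k <= phi p -> ~ nb Q p m.
  move=> pm kp pmN; apply: (mmin p) => //; split=> //.
  by rewrite -(phiC _ _ pmN).
have psiN x y : x != m -> y != m -> (psi x < psi y) = (phi x < phi y).
  move=> xm ym; rewrite !psiE /promote !eqm (negbTE xm) (negbTE ym).
  by rewrite -(eqm x) in xm; rewrite -(eqm y) in ym; (do 2?case: ifP); lia.
have psim_lt y : y != m -> (psi m < psi y) = (k <= phi y).
  move=> ym; rewrite psim psiE /promote eqm (negbTE ym).
  by rewrite -eqm in ym; case: ifP; lia.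
have psi_ltm x : x != m -> (psi x < psi m) = (phi x < k).
  move=> xm; rewrite psim psiE /promote eqm (negbTE xm).
  by rewrite -eqm in xm; case: ifP; lia.
split.
- move=> x y xyN; rewrite -(phiC _ _ xyN).
  have [xm|xm] := eqVneq x m; have [ym|ym] := eqVneq y m.
  + by rewrite xm ym !ltnn.
  + have := moved y; rewrite xm psim_lt // => h.
    apply/idP/idP => [ky|]; last by lia.
    case: (ltngtP (phi m) (phi y)) => // [ym'|/val_inj/perm_inj e].
      by case: (h ym' ky); apply: nb_sym; rewrite -xm.
    by move: ym; rewrite e eqxx.
  + have := moved x; rewrite ym psi_ltm // => h.
    apply/idP/idP => [|xm']; first by lia.
    by rewrite ltnNge; apply/negP => /(h xm'); apply; rewrite -ym.
  + exact: psiN.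
- move=> x y kx ky.
  have xm : x != m by apply: contraTneq kx => ->; rewrite psim ltnn.
  have ym : y != m by apply: contraTneq ky => ->; rewrite psim ltnn.
  by rewrite psiN // phiS // leqNgt -psi_ltm // psim -leqNgt ltnW.
(* Only pairs starting at [m] are new; the others fall under the old invariant. *)
move=> x y xk xy; have [xm|xm] := eqVneq x m; last first.
  have xk' : phi x < k.
    by rewrite -psi_ltm // psim; move: xk; rewrite -psim ltnS leq_eqVlt;
      case/orP => // /eqP/val_inj/perm_inj e; rewrite e eqxx in xm.
  apply: phiK => //; have [->|ym] := eqVneq y m; first exact: leq_trans km.
  by rewrite -psiN.
have ym : y != m by apply: contraTneq xy => ->; rewrite xm ltnn.
rewrite xm psim_lt // in xy *.
(* If the source [x0] leading to [y] is not [m], it is below [m]. When [m] is below [y],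
   [chain_through] yields a chain from [m] to [y], since none ends at [m]. An incomparable [y] is
   joined to [m] by a step, which must leave [m]. *)
have [x0 x0s x0y] := ex_source phiC xy.
have [x0m|x0m] := eqVneq x0 m.
  by case: x0y => [e|h]; [rewrite -e x0m eqxx in ym | left; rewrite -x0m].
have Qx0 := mtop _ x0s x0m.
case: x0y => [<-|x0y]; first by right.
have [|ymN] := boolP (Q y m); first by right.
left; have [my|myN] := boolP (Q m y).
  have [x0m'|//] := chain_through Qx0 my x0y.
  by case: (source_chain phiC ms _ x0m'); case: x0s.
have ymC := incomp_nb ymN myN; case: (ltngtP y m) => [lt|gt|/val_inj e].
- by case: (mmin y).
- by apply: chain_step; split => //; apply: nb_sym.
- by rewrite e eqxx in ym.
Qed.

(** If [phi] kept the order of a pair that [psi] reverses, the invariant would give a chain, which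
    [psi] respects, or a cycle in [Q]. *)
Lemma greedy_inv_max phi psi : greedy_inv n phi -> compat Q psi ->
  le_compat Q psi phi.
Proof.
move=> [_ _ phiK] psiC x y xy yx; have [xy'|//|/val_inj/perm_inj e] := ltngtP (phi x) (phi y).
  have [/(chain_lt psiC)|yx'] := phiK _ _ (ltn_ord (phi x)) xy'; first by lia.
  by have := Qtrans xy yx'; rewrite Qirr.
by move: yx; rewrite e ltnn.
Qed.

End Greedy.

(** * Boxes of a diagram and the steps of the north-east filling *)

Section Boxes.

Variables (n : nat) (Q : rel 'I_n) (D : diagram) (bx : 'I_n -> nat * nat).
Local Notation col x := (bx x).1.
Local Notation row x := (bx x).2.
Hypothesis bxI : injective bx.
Hypothesis mem_D : forall b, reflect (exists x, b = bx x) (b \in D).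
Hypothesis QE : forall x y,
  Q x y = [&& x != y, col x <= col y & row x <= row y].
(** Positions are numbered as in [fill_down]: columns from the left, each from its top. *)
Hypothesis ltE : forall x y : 'I_n,
  (x < y) = (col x < col y) || ((col x == col y) && (row y < row x)).
Implicit Types (x y z p q m i j : 'I_n) (phi psi : 'S_n) (F : filling).

Lemma box_eq x y : col x = col y -> row x = row y -> x = y.
Proof. by move=> c r; apply: bxI; rewrite (surjective_pairing (bx x)) c r -surjective_pairing. Qed.

Lemma box_irr : irreflexive Q.
Proof. by move=> x; rewrite QE eqxx. Qed.

Lemma box_trans : transitive Q.
Proof.
move=> y x z; rewrite !QE => /and3P[xy cxy rxy] /and3P[yz cyz ryz].
rewrite (leq_trans cxy cyz) (leq_trans rxy ryz) !andbT.
by apply: contraNneq xy => xz; apply/eqP/box_eq; move: cyz ryz; rewrite -xz; lia.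
Qed.

(** Whatever lies between two boxes of a column is in that column, so splitting at intermediate
    boxes ends with [nb] pairs. The upper box has the smaller label, so the chain runs downwards. *)
Lemma chain_col x y : col x = col y -> row x < row y -> chain Q y x.
Proof.
move: {2}(row y - row x) (leqnn (row y - row x)) => N.
elim: N x y => [|N IHN] x y; first by lia.
move=> le c r; have [/existsP[z /andP[]]|] := boolP [exists z, Q x z && Q z y].
  rewrite !QE => /and3P[xz cxz rxz] /and3P[zy czy rzy].
  have cz : col z = col x by lia.
  have rxz' : row x < row z.
    rewrite ltn_neqAle rxz andbT; apply: contraNneq xz => e.
    by apply/eqP/box_eq.
  have rzy' : row z < row y.
    rewrite ltn_neqAle rzy andbT; apply: contraNneq zy => e.
    by apply/eqP/box_eq => //; rewrite cz.
  by apply: (@chain_trans _ _ _ z); apply: IHN; lia.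
rewrite negb_exists => /forallP h; apply: chain_step; split.
  by rewrite ltE c eqxx r orbT.
move=> z; split; last by have /negP := h z.
by rewrite !QE => /andP[/and3P[_ _ ?] /and3P[_ _ ?]]; lia.
Qed.

Lemma chain_row x y : row x = row y -> col x < col y -> chain Q x y.
Proof.
move: {2}(col y - col x) (leqnn (col y - col x)) => N.
elim: N x y => [|N IHN] x y; first by lia.
move=> le r c; have [/existsP[z /andP[]]|] := boolP [exists z, Q x z && Q z y].
  rewrite !QE => /and3P[xz cxz rxz] /and3P[zy czy rzy].
  have rz : row z = row x by lia.
  have cxz' : col x < col z.
    rewrite ltn_neqAle cxz andbT; apply: contraNneq xz => e.
    by apply/eqP/box_eq.
  have czy' : col z < col y.
    rewrite ltn_neqAle czy andbT; apply: contraNneq zy => e.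
    by apply/eqP/box_eq => //; rewrite rz.
  by apply: (@chain_trans _ _ _ z); apply: IHN; lia.
rewrite negb_exists => /forallP h; apply: chain_step; split.
  by rewrite ltE c.
move=> z; split; first by have /negP := h z.
by rewrite !QE => /andP[/and3P[_ ? _] /and3P[_ ? _]]; lia.
Qed.

(** A [Q]-pair that the labels themselves reverse lies in one column, where [chain_col] forces the
    reversal for every compatible [psi]. *)
Lemma box_min psi : compat Q psi -> le_compat Q 1%g psi.
Proof.
move=> psiC x y; rewrite QE !perm1 ltE => /and3P[xy cxy rxy] yx.
by apply: chain_lt psiC _; apply: chain_col; lia.
Qed.

Lemma box_ofE F phi i : (forall x, F (bx x) = phi x) ->
  box_of D F i = bx (phi^-1%g i).
Proof.
move=> FE; rewrite /box_of.
(* The entry [i] occurs in [D], so the default box is never returned. *)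
have hasD : has (fun b => F b == i) D.
  apply/hasP; exists (bx (phi^-1%g i)); last by rewrite FE permKV.
  by apply/mem_D; exists (phi^-1%g i).
have := nth_find (0, 0) hasD; set b := nth _ _ _ => /eqP Fb.
have /mem_D[x bE] : b \in D by apply: mem_nth; rewrite -has_find.
rewrite bE; congr bx; apply: (@perm_inj _ phi); rewrite permKV.
by apply: val_inj; rewrite /= -FE -bE.
Qed.

Lemma fill_downE x : fill_down D (bx x) = x.
Proof.
rewrite /fill_down; set X := [fset _ in _ | _]%fset.
pose A := [seq bx y | y <- enum [set y : 'I_n | y < x]].
have uA : uniq A by rewrite map_inj_uniq ?enum_uniq.
have /perm_size : perm_eq X A.
  apply: uniq_perm => //.
  move=> b; apply/idP/mapP.
    rewrite !inE /= => /andP[/mem_D[y ->] h]; exists y => //.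
    by rewrite mem_enum inE ltE.
  move=> [y]; rewrite mem_enum inE ltE => h ->; rewrite !inE /= h andbT.
  by apply/mem_D; exists y.
by move=> ->; rewrite size_map -cardE card_ord_lt // ltnW.
Qed.

Lemma fill_posetE F phi i j : (forall x, F (bx x) = phi x) ->
  fill_poset D F i j = (col (phi^-1%g i) <= col (phi^-1%g j))
                    && (row (phi^-1%g i) <= row (phi^-1%g j)).
Proof. by move=> FE; rewrite /fill_poset !(box_ofE _ FE). Qed.

(** The poset of the filling is [Q] carried along by [phi], so being a cover does not depend on the
    labels. *)
Lemma coversE F phi p m : (forall x, F (bx x) = phi x) -> Q p m ->
  reflect (nb Q p m) (covers (fill_poset D F) (phi p) (phi m)).
Proof.
move=> FE pm; have := pm; rewrite QE => /and3P[pmN cpm rpm].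
have leE x y : fill_poset D F (phi x) (phi y) = (x == y) || Q x y.
  rewrite (fill_posetE _ _ FE) !permK QE.
  by have [->|//] := eqVneq x y; rewrite !leqnn.
rewrite /covers (inj_eq perm_inj) pmN leE pm orbT /=.
apply: (iffP forallP) => [h z|h z].
  split; case/andP => [a b].
    have := h (phi z); rewrite !leE a b !orbT /= !(inj_eq perm_inj).
    by case/orP => /eqP e; move: a b; rewrite e box_irr.
  by have := box_trans (box_trans a b) pm; rewrite box_irr.
rewrite -(permKV phi z) !leE !(inj_eq perm_inj); move: (phi^-1%g z) => {}z.
apply/implyP => /orP[/eqP->|pz]; first by rewrite eqxx implybT.
apply/implyP => /orP[/eqP->|zm]; first by rewrite eqxx orbT.
by have [[]] := h z; apply/andP.
Qed.

Lemma covers_above F phi p m : (forall x, F (bx x) = phi x) -> Q p m ->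
  ~~ covers (fill_poset D F) (phi m) (phi p).
Proof.
move=> FE; rewrite QE => /and3P[pm cpm rpm].
rewrite /covers (fill_posetE _ _ FE) !permK; apply/negP => /and3P[_ /andP[c r] _].
by case/eqP: pm; apply: box_eq; lia.
Qed.

Section Step.

Variables (F : filling) (phi : 'S_n) (i : 'I_n).
Hypothesis FE : forall x, F (bx x) = phi x.
Hypothesis inv : greedy_inv Q i phi.
Local Notation b := (phi^-1%g i).

(** Not being [nb], the pair is comparable; [chain_col] and [chain_row] would give a chain into the
    source [m] if it shared a column or a row. *)
Lemma source_left m p : source Q i phi m -> i <= phi p -> p < m ->
  [/\ row p < row m, col p < col m, Q p m & ~ nb Q p m].
Proof.
have phiC := greedy_compat inv.
move=> ms ip pm; have pmN : ~ nb Q p m by move=> h; case: ms => _ /(_ p ip); apply.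
have nochain := source_chain phiC ms ip.
have pmQ : Q p m || Q m p.
  by apply: contra_notT pmN; rewrite negb_or => /andP[]; apply: (incomp_nb box_trans).
move: (pm); rewrite ltE => /orP[cpm|/andP[/eqP c r]]; last first.
  by case: nochain; apply: chain_col.
have {}pmQ : Q p m by case/orP: pmQ => //; rewrite QE => /and3P[_]; lia.
split=> //; move: pmQ; rewrite QE => /and3P[_ _].
rewrite leq_eqVlt => /orP[/eqP r|//]; by case: nochain; apply: chain_row.
Qed.

(** The box [b] holds the smallest unplaced label, and steps increase labels. *)
Lemma source_first : source Q i phi b.
Proof.
split; first by rewrite permKV.
move=> q iq [qb qbN]; move: qb; rewrite -(greedy_compat inv qbN) permKV; lia.
Qed.

(** An unplaced [q] with a step to [m] has a label between [i] and that of [m], so condition (ii) of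
    the construction applies to it and excludes the cover. Conversely [source_left] yields the
    conditions, as unplaced entries are sorted. *)
Lemma sourceP m : m != b -> reflect (source Q i phi m) (ne_candidate D F i (phi m)).
Proof.
have [phiC phiS _] := inv.
move=> mb; rewrite /ne_candidate !(box_ofE _ FE) permK; apply: (iffP and3P).
  move=> [im _ /forallP h]; split; first exact: ltnW.
  move=> q iq [qm qmN]; have qm' : phi q < phi m by rewrite phiC.
  have := h (phi q); rewrite iq qm' /= (box_ofE _ FE) permK => /and4P[r c cv _].
  have qmQ : Q q m by rewrite QE c (ltnW r) -val_eqE /= (ltn_eqF qm).
  by move/negP: cv; apply; apply/(coversE FE qmQ).
move=> ms; have [im _] := ms; have im' : i < phi m.
  rewrite ltn_neqAle im andbT; apply: contraNneq mb => /val_inj ->.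
  by rewrite permK.
have left q : i <= phi q -> phi q < phi m ->
    [/\ row q < row m, col q < col m, Q q m & ~ nb Q q m].
  by move=> iq qm; apply: source_left => //; rewrite -phiS // ltnW.
split=> //; first by have [|| r c _ _] := left b; rewrite ?permKV //; apply/andP.
apply/forallP => j; apply/implyP => /andP[ij jm]; rewrite !(box_ofE _ FE).
have [|| r c q qN] := left (phi^-1%g j); rewrite ?permKV //.
rewrite r ltnW //=; rewrite -(permKV phi j) (covers_above FE q) andbT.
by apply/(coversE FE q).
Qed.

Lemma ne_stepP : exists psi, greedy_inv Q i.+1 psi /\
  forall x, ne_step D F i (bx x) = psi x.
Proof.
have [phiC phiS _] := inv.
rewrite /ne_step /ne_choice; case: pickP => [x0|none].
  rewrite -(permKV phi x0); move: (phi^-1%g x0) => m /andP[cand /forallP top].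
  have mb : m != b.
    by apply: contraTneq cand => ->; rewrite permKV /ne_candidate ltnn.
  have ms := cand; move/(sourceP mb) in ms.
  have [psi psiE] : exists psi : 'S_n,
      forall p, psi p = promote i (phi m) (phi p) :> nat.
    by apply: ex_promote; case: ms.
  exists psi; split; last first.
    move=> x; rewrite psiE /promote !FE.
    by rewrite (inj_eq val_inj).
  apply: (greedy_inv_step box_trans inv ms _ psiE) => x xs xm.
  (* A source with a smaller position is below [m] by [source_left]; one with a larger position
     would be a candidate higher than [m]. *)
  case: (ltngtP x m) => [lt|gt|/val_inj e]; last by rewrite e eqxx in xm.
    by have [] := source_left ms (proj1 xs) lt.
  have [r _ _ _] := source_left xs (proj1 ms) gt.
  have xb : x != b.
    apply: contraTneq gt => ->; rewrite -phiS ?permKV //; last by case: ms.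
    by rewrite -leqNgt; case: ms.
  have := top (phi x); rewrite (introT (sourceP xb)) //= !(box_ofE _ FE) !permK.
  by lia.
(* Any candidate would yield an uppermost one, so only [b] is a source; it is then promoted to its
   own place and the filling stays the same. *)
have only x : source Q i phi x -> x = b.
  move=> xs; apply/eqP; apply: contraT => xb.
  have cx : ne_candidate D F i (phi x) by apply/sourceP.
  case: (arg_maxnP (fun y => (box_of D F y).2) cx) => y cy ymax.
  have := none y; rewrite cy /= => /negP[]; apply/forallP => z.
  by apply/implyP => /ymax.
have [psi psiE] : exists psi : 'S_n,
    forall p, psi p = promote i (phi b) (phi p) :> nat.
  by apply: ex_promote; rewrite permKV.
exists psi; split.
  apply: (greedy_inv_step box_trans inv source_first _ psiE) => x /only ->.
  by rewrite eqxx.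
by move=> x; rewrite FE psiE permKV /promote; case: ifP => [/eqP//|_]; case: ifP => //; lia.
Qed.

End Step.

Lemma fill_neP : exists phi, [/\ compat Q phi,
  forall psi, compat Q psi -> le_compat Q psi phi &
  forall x, fill_ne n D (bx x) = phi x].
Proof.
suff main k : k <= n -> exists phi, greedy_inv Q k phi /\
    forall x, foldl (@ne_step n D) (fill_down D) (take k (enum 'I_n)) (bx x) = phi x.
  have [phi [phiI phiE]] := main n (leqnn n); exists phi; split.
  - exact: greedy_compat phiI.
  - by move=> psi; apply: greedy_inv_max box_irr box_trans _ _ phiI.
  - by move=> x; rewrite /fill_ne -phiE take_oversize // size_enum_ord.
elim: k => [|k IHk] kn.
  exists 1%g; split; first exact: greedy_inv0.
  by move=> x; rewrite take0 perm1 /= fill_downE.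
have [phi [phiI phiE]] := IHk (ltnW kn).
have -> : take k.+1 (enum 'I_n) = rcons (take k (enum 'I_n)) (Ordinal kn).
  rewrite (take_nth (Ordinal kn)) ?size_enum_ord //; congr rcons.
  by apply: val_inj; rewrite /= nth_enum_ord.
by rewrite foldl_rcons; apply: (@ne_stepP _ phi (Ordinal kn) phiE phiI).
Qed.

End Boxes.

(** * Indices of blocks, and the longest elements of parabolic subgroups *)

Lemma nth_leq_count (s : seq nat) x i : sorted ltn s -> i < size s ->
  (nth 0 s i <= x) = (i < count (leq^~ x) s).
Proof.
elim: s i => // a s IHs i /= sa; have /allP als := order_path_min ltn_trans sa.
have ss := path_sorted sa.
have c0 : x < a -> count (leq^~ x) s = 0.
  move=> xa; apply/eqP; rewrite eqn0Ngt -has_count; apply/hasPn => b /als ab.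
  by rewrite -ltnNge (ltn_trans xa).
case: i => [|i] /= is_; first by have [ax|/c0->] := leqP a x; rewrite ?addn0.
rewrite ltnS in is_; rewrite IHs //.
have [ax|xa] := leqP a x; first by rewrite add1n ltnS.
by rewrite c0.
Qed.

Section Ranks.

Variable n : nat.
Implicit Types (A S : {set 'I_n.-1}) (i : 'I_n.-1) (x y : 'I_n) (s r w : 'S_n).

(** The number of cuts before the ordinal [k]; its successor is the index of the block containing
    [k], see [mem_block]. *)
Definition below A (k : nat) : nat := #|[set i in A | i < k]|.

Lemma below_mono A k l : k <= l -> below A k <= below A l.
Proof.
move=> kl; apply/subset_leq_card/subsetP => i.
by rewrite !inE => /andP[-> /leq_trans]; apply.
Qed.

Lemma below0 A : below A 0 = 0.
Proof. by apply/eqP; rewrite cards_eq0; apply/eqP/setP => i; rewrite !inE andbF. Qed.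

Lemma below_max A : below A n.-1 = #|A|.
Proof. by apply: eq_card => i; rewrite inE ltn_ord andbT. Qed.

Lemma below_le A k : below A k <= #|A|.
Proof. by apply/subset_leq_card/subsetP => i; rewrite inE => /andP[]. Qed.

Lemma below_hi A i : below A (hi i) = (i \in A) + below A (lo i).
Proof.
rewrite /below (cardsD1 i) !inE /= ltnSn andbT; congr (_ + _).
apply: eq_card => j; rewrite !inE ltnS /= ltn_neqAle -val_eqE.
by case: (_ != _) => //=; rewrite ?andbF.
Qed.

Lemma below_same A i (a b : nat) : a <= i < b -> i \in A -> below A a < below A b.
Proof.
move=> /andP[ai ib] iA; apply: proper_card; apply/properP; split.
  apply/subsetP => j; rewrite !inE => /andP[-> ja]; lia.
by exists i; rewrite inE iA //= ltnNge ai.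
Qed.

(** The count starts at 0 and grows by at most 1 at each position. Hence no column or row of a
    diagram is empty. *)
Lemma below_surj A c : 0 < n -> c <= #|A| -> exists x, below A x = c.
Proof.
move=> n_gt0; rewrite -below_max.
have : n.-1 < n by lia.
elim: n.-1 {-2}n.-1 (leqnn n.-1) => [|N IHN] m mN mn cm.
  exists (Ordinal mn); move: cm mN; rewrite leqn0 => + /eqP m0.
  by rewrite /= m0 below0 leqn0 => /eqP.
case: m mN mn cm => [|m] mN mn cm.
  by exists (Ordinal mn); move: cm; rewrite /= below0 leqn0 => /eqP.
have [//|e] := leqP c (below A m); first by apply: IHN; lia.
exists (Ordinal mn); apply/eqP; rewrite eqn_leq cm andbT /=.
have mn' : m < n by lia.
have [i [lx hx]] := @ex_lo _ (Ordinal mn') (Ordinal mn) erefl.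
have := below_hi A i; rewrite lx hx /= => ->; lia.
Qed.

Lemma sorted_enum A : sorted ltn [seq (val i).+1 | i <- enum A].
Proof.
rewrite sorted_map /enum_mem -enumT; apply: sorted_filter.
  by move=> a b c /=; lia.
have := iota_ltn_sorted 0 n.-1; rewrite -val_enum_ord sorted_map.
by apply: sub_sorted => a b.
Qed.

Lemma below_count A k : below A k = count (leq^~ k) [seq (val i).+1 | i <- enum A].
Proof.
rewrite count_map -size_filter /below cardE /enum_mem -filter_predI.
by congr size; apply: eq_filter => i; rewrite /= !inE andbC.
Qed.

Lemma mem_block A x j : 0 < j <= #|A|.+1 ->
  (x \in block A j) = (j == (below A x).+1).
Proof.
case: j => // j; rewrite ltnS /= => jA; rewrite inE /=.
pose s := [seq (val i).+1 | i <- enum A].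
have ss : size s = #|A| by rewrite size_map -cardE.
have ge k : k <= #|A| -> (nth 0 (cuts A) k < x.+1) = (k <= below A x).
  case: k => // k kA; rewrite ltnS /= nth_rcons ss kA below_count.
  by rewrite nth_leq_count ?sorted_enum ?ss.
rewrite ge // eqSS; have := below_le A x.
(* The last block ends at the added cut [n], which bounds every position. *)
move: jA; rewrite ltnS leq_eqVlt => /orP[/eqP jA|jA].
  rewrite /= nth_rcons ss jA ltnn eqxx ltn_ord andbT; lia.
have := ge j.+1 jA; rewrite /= leqNgt ltnS; lia.
Qed.

Lemma asc_run w x y : x < y -> (forall i, x <= i < y -> i \notin DesL w) ->
  w^-1%g x < w^-1%g y.
Proof.
move: {2}(y - x).-1 (erefl (y - x).-1) => d.
elim: d y => [|d IHd] y yd xy asc.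
  have [i [lx hy]] : exists i, lo i = x /\ hi i = y by apply: ex_lo; lia.
  rewrite -lx -hy -mem_DesLN; apply: asc.
  by have := congr1 val lx; have := congr1 val hy => /=; lia.
have zn : y.-1 < n by have := ltn_ord y; lia.
have yz : y = (Ordinal zn).+1 :> nat by rewrite /=; lia.
have [i [lz hy]] := ex_lo yz; apply: (@ltn_trans (w^-1%g (Ordinal zn))).
  by apply: IHd => [||j /= jz]; [rewrite /=; lia..|apply: asc; lia].
rewrite -lz -hy -mem_DesLN; apply: asc.
by have := congr1 val lz; have := congr1 val hy => /=; lia.
Qed.

Lemma desc_run w x y : x < y -> (forall i, x <= i < y -> i \in DesL w) ->
  w^-1%g y < w^-1%g x.
Proof.
move: {2}(y - x).-1 (erefl (y - x).-1) => d.
elim: d y => [|d IHd] y yd xy desc.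
  have [i [lx hy]] : exists i, lo i = x /\ hi i = y by apply: ex_lo; lia.
  rewrite -lx -hy -mem_DesL; apply: desc.
  by have := congr1 val lx; have := congr1 val hy => /=; lia.
have zn : y.-1 < n by have := ltn_ord y; lia.
have yz : y = (Ordinal zn).+1 :> nat by rewrite /=; lia.
have [i [lz hy]] := ex_lo yz; apply: (@ltn_trans (w^-1%g (Ordinal zn))).
  rewrite -lz -hy -mem_DesL; apply: desc.
  by have := congr1 val lz; have := congr1 val hy => /=; lia.
by apply: IHd => [||j /= jz]; [rewrite /=; lia..|apply: desc; lia].
Qed.

Lemma max_len_DesL w i : len (refl i ** w) <= len w -> i \in DesL w.
Proof.
rewrite mem_DesL !len_inversions; case: (lo_hi_cases i w) => // h.
by rewrite card_inversions_asc // ltnn.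
Qed.

Lemma w0_lt x y : (w0 n x < w0 n y) = (y < x).
Proof.
have des i : i \in DesL (w0 n).
  apply: max_len_DesL; rewrite /w0; case: arg_maxnP => // w _ wmax; exact: wmax.
have lt u v : w0 n u < w0 n v -> v < u.
  by move=> uv; have := desc_run uv (fun i _ => des i); rewrite !permK.
case: (ltngtP (w0 n x) (w0 n y)) => [/lt//|/lt xy|/val_inj/perm_inj->].
  by rewrite ltnNge ltnW.
by rewrite ltnn.
Qed.

Lemma below_refl A i x : i \notin A -> below A (refl i x) = below A x.
Proof.
move=> /negbTE iA; rewrite /refl; have := below_hi A i; rewrite iA add0n => e.
by case: tpermP => [->|->|].
Qed.

(** A generator [refl i] with [i] in [S] swaps two elements of one block of [~: S]. *)
Lemma below_parabolic S s x : s \in <<[set refl i | i in S]>>%g ->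
  below (~: S) (s x) = below (~: S) x.
Proof.
move=> /gen_prodgP[m [c cS ->]].
pose P (t : 'S_n) := forall y, below (~: S) (t y) = below (~: S) y.
apply: (big_ind P) => [y|s1 s2 h1 h2 y|i _ y].
- by rewrite perm1.
- by rewrite permM h2 h1.
- by have /imsetP[j jS ->] := cS i; rewrite below_refl // inE jS.
Qed.

(** The longest element preserves each block of [~: S]; inside a block all indices are in [S], hence
    descents by maximality of the length. *)
Lemma w0_of_lt S x y : (w0_of S x < w0_of S y) =
  (below (~: S) x < below (~: S) y) ||
  ((below (~: S) x == below (~: S) y) && (y < x)).
Proof.
rewrite /w0_of; case: arg_maxnP => [|w wS wmax]; first exact: group1.
have des i : i \in S -> i \in DesL w.
  move=> iS; apply/max_len_DesL/wmax; rewrite /compp groupM //.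
  by apply: mem_gen; apply: imset_f.
have lt u v : w u < w v -> (below (~: S) u < below (~: S) v) ||
    ((below (~: S) u == below (~: S) v) && (v < u)).
  move=> uv; rewrite -(below_parabolic u wS) -(below_parabolic v wS).
  have := below_mono (~: S) (ltnW uv); rewrite leq_eqVlt => /orP[/eqP e|->//].
  rewrite e eqxx /= ltnn /=.
  have : w^-1%g (w v) < w^-1%g (w u); last by rewrite !permK.
  apply: desc_run => // i iuv; apply: des; apply: contraT => iS.
  have /(below_same iuv) : i \in ~: S by rewrite inE.
  by rewrite e ltnn.
case: (ltngtP (w x) (w y)) => [/lt->//|/lt|/val_inj/perm_inj->]; last by rewrite !ltnn andbF.
by lia.
Qed.

End Ranks.

(** * Intervals read off from diagrams *)

Section Diagram.

Variable n : nat.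
Implicit Types (A S : {set 'I_n.-1}) (i : 'I_n.-1) (x y : 'I_n) (s r w : 'S_n).

Lemma SigmaL_interval s r (P : rel 'I_n) : leL s r ->
  (forall x y, P x y = (x == y) || ltI s r x y) -> SigmaL P = intervalL s r.
Proof.
move=> sr PE; apply/setP => g; rewrite inE; apply/forallP/(mem_intervalL _ sr).
  move=> gP x y xy; have /forallP/(_ y) := gP x; rewrite PE xy orbT /=.
  rewrite leq_eqVlt => /orP[/eqP/val_inj/perm_inj e|//].
  by move: xy; rewrite e ltI_irr.
move=> gP x; apply/forallP => y; rewrite PE; apply/implyP.
by move=> /orP[/eqP->//|/gP/ltnW].
Qed.

(** The column is the index of the block [X_i] of [r x], the row that of its block [Y_j]. *)
Definition pos_box S r x : nat * nat :=
  ((below (~: S) x).+1, (below (DesL r) (r x)).+1).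

Lemma mem_boxes b k l : (b \in [seq (p, q) | p <- iota 1 k.+1, q <- iota 1 l.+1]) =
  (0 < b.1 <= k.+1) && (0 < b.2 <= l.+1).
Proof.
case: b => i j; apply/allpairsP/idP => [[[i' j'] [+ + [-> ->]]]|/andP[ik jl]].
  by rewrite !mem_iota !add1n !ltnS => -> ->.
by exists (i, j); rewrite !mem_iota !add1n !ltnS.
Qed.

Lemma occupied_box A B s b :
  reflect (exists x, b = ((below A x).+1, (below B (s x)).+1))
    ((b \in [seq (p, q) | p <- iota 1 #|A|.+1, q <- iota 1 #|B|.+1]) &&
     (s @: block A b.1 :&: block B b.2 != set0)).
Proof.
rewrite mem_boxes; apply: (iffP andP) => [[/andP[b1 b2]]|[x ->]]; last first.
  rewrite /= !ltnS !below_le; split=> //; apply/set0Pn; exists (s x).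
  by rewrite inE imset_f ?mem_block ?ltnS ?below_le /=.
move=> /set0Pn[y]; rewrite inE => /andP[/imsetP[x + ->]].
rewrite !mem_block // => /eqP b1E /eqP b2E; exists x.
by rewrite -b1E -b2E -surjective_pairing.
Qed.

Lemma mem_diag_above S r b :
  reflect (exists x, b = pos_box S r x) (b \in diag_above S r).
Proof.
apply: (iffP (imfsetP _ _ _ _)) => [[c]|[x ->]].
  by rewrite inE => /(occupied_box (~: S) (DesL r) r)[x ->] ->; exists x.
exists (pos_box S r x) => //; rewrite inE.
by apply/(occupied_box (~: S) (DesL r) r); exists x.
Qed.

Section Above.

Variables (S : {set 'I_n.-1}) (r : 'S_n).
Hypothesis wr : leL (w0_of S) r.
Local Notation col x := (pos_box S r x).1.
Local Notation row x := (pos_box S r x).2.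

Lemma same_col_desc x y : x < y -> below (~: S) x = below (~: S) y -> r y < r x.
Proof.
move=> xy e; apply: (leLP _ _ wr) => //.
by rewrite w0_of_lt e eqxx xy orbT.
Qed.

Lemma same_row_asc x y : r x < r y -> row x = row y -> x < y.
Proof.
move=> xy [e]; have : r^-1%g (r x) < r^-1%g (r y); last by rewrite !permK.
apply: asc_run => // i ixy; apply/negP => /(below_same ixy).
by rewrite e ltnn.
Qed.

(** Within a column [r] decreases, since it keeps the inversions of [w0_of S]; within a row
    positions increase with values, as a block contains no descent. So successive positions of a
    column go strictly down. *)
Lemma pos_box_lt x y :
  (x < y) = (col x < col y) || ((col x == col y) && (row y < row x)).
Proof.
have lt (u v : 'I_n) : u < v -> (col u < col v) || ((col u == col v) && (row v < row u)).
  move=> uv; have := below_mono (~: S) (ltnW uv).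
  rewrite leq_eqVlt => /orP[/eqP e|]; last by rewrite /= ltnS => ->.
  have ruv := same_col_desc uv e; rewrite /= e eqxx ltnn /=.
  have := below_mono (DesL r) (ltnW ruv).
  rewrite leq_eqVlt => /orP[/eqP e'|//].
  have := @same_row_asc v u ruv; rewrite /= e' => /(_ erefl); lia.
case: (ltngtP x y) => [/lt->//|/lt|/val_inj->]; first by lia.
by rewrite !ltnn andbF.
Qed.

Lemma pos_box_inj : injective (pos_box S r).
Proof.
move=> x y e; have := pos_box_lt x y; have := pos_box_lt y x.
by rewrite e !ltnn !andbF /=; case: (ltngtP x y) => // /val_inj.
Qed.

(** If [y] is weakly right of and above [x] while [r y < r x], the rows agree and [same_row_asc]
    puts [y] before [x], against [pos_box_lt]. *)
Lemma ltI_pos_box x y :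
  ltI (w0_of S) r x y = [&& x != y, col x <= col y & row x <= row y].
Proof.
have [->|xy] := eqVneq x y; first by rewrite ltI_irr.
have cE : (w0_of S x < w0_of S y) =
    (col x < col y) || ((col x == col y) && (y < x)).
  by rewrite w0_of_lt.
have := pos_box_lt x y; have := pos_box_lt y x.
rewrite /ltI cE.
have rxy : r x < r y -> row x <= row y by move=> /ltnW/(below_mono (DesL r)).
have ryx : r y < r x -> row y <= row x by move=> /ltnW/(below_mono (DesL r)).
have sxy := @same_row_asc x y; have syx := @same_row_asc y x.
have := perm_lt_neq r xy.
move: (col x) (col y) (row x) (row y) rxy ryx sxy syx => cx cy ox oy.
case: (ltngtP (r x) (r y)); lia.
Qed.

Lemma diag_above_filling : exists phi, [/\ compat (ltI (w0_of S) r) phi,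
  forall psi, compat (ltI (w0_of S) r) psi -> le_compat (ltI (w0_of S) r) psi phi &
  forall x, fill_ne n (diag_above S r) (pos_box S r x) = phi x].
Proof.
exact: (fill_neP pos_box_inj (mem_diag_above S r) ltI_pos_box pos_box_lt).
Qed.

Lemma one_le_compat psi : compat (ltI (w0_of S) r) psi ->
  le_compat (ltI (w0_of S) r) 1%g psi.
Proof.
exact: (box_min pos_box_inj ltI_pos_box pos_box_lt).
Qed.

End Above.

Lemma SigmaL_shift s r phi (D : diagram) (F : filling) (bx : 'I_n -> nat * nat) :
  leL s r -> compat (ltI s r) phi ->
  (forall b, reflect (exists x, b = bx x) (b \in D)) ->
  (forall x y, ltI s r x y = [&& x != y, (bx x).1 <= (bx y).1 & (bx x).2 <= (bx y).2]) ->
  (forall x, F (bx x) = phi x) ->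
  SigmaL (fill_poset D F) = intervalL (s ** phi^-1%g) (r ** phi^-1%g).
Proof.
move=> sr phiC mem_D QE FE; apply: SigmaL_interval; first exact: compat_leL.
move=> a b; rewrite (fill_posetE mem_D _ _ FE) /ltI !comppE -/(ltI s r _ _) QE.
by rewrite (inj_eq perm_inj); have [->|//] := eqVneq a b; rewrite !leqnn.
Qed.

Lemma compat1 Q : @compat n Q 1%g.
Proof. by move=> x y _; rewrite !perm1. Qed.

Lemma shift1 s : s ** 1^-1%g = s.
Proof. by rewrite /compp invg1 mul1g. Qed.

(** * Duality by left multiplication by the longest element *)

Section Duality.

Implicit Types (Q : rel 'I_n) (phi psi : 'S_n).

Lemma compat_dual Q Q' phi : (forall x y, Q' x y = Q y x) ->
  compat Q phi -> compat Q' phi.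
Proof.
move=> QE phiC x y xyN; apply: phiC => z.
by have [] := xyN z; rewrite !QE !(andbC (Q _ z)) => h1 h2; split.
Qed.

(** In the opposite poset the reversed pairs form the complement, so inclusion turns around. *)
Lemma le_compat_dual Q Q' phi psi : (forall x y, Q x y -> x != y) ->
  (forall x y, Q' x y = Q y x) -> le_compat Q phi psi -> le_compat Q' psi phi.
Proof.
move=> Qne QE le x y; rewrite QE => yx; have yxN := Qne _ _ yx.
by rewrite perm_lt_neq // [phi y < _]perm_lt_neq //; apply: contra => /(le _ _ yx).
Qed.

Lemma ltI_w0 s r x y : ltI (w0 n ** r) (w0 n ** s) x y = ltI s r y x.
Proof. by rewrite /ltI !comppE !w0_lt andbC. Qed.

Lemma leL_w0 s r : leL s r -> leL (w0 n ** r) (w0 n ** s).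
Proof.
move=> /leLP sr; apply/leLP => x y xy; rewrite !comppE !w0_lt => rxy.
have yx : y != x by rewrite -val_eqE /=; lia.
by rewrite [_ < _]perm_lt_neq 1?eq_sym //; apply/negP => /(sr _ _ xy); lia.
Qed.

Lemma w0_rev : w0 n = perm rev_ord_inj.
Proof.
apply: perm_eq_order => x y; rewrite w0_lt !permE /=.
by have := ltn_ord x; have := ltn_ord y; lia.
Qed.

Lemma w0K : w0 n ** w0 n = 1%g.
Proof. by apply/permP => x; rewrite comppE w0_rev !permE rev_ordK. Qed.

Lemma w0_w1 S : w0 n ** w1_of S = w0_of (~: S).
Proof. by rewrite /w1_of comppA w0K /compp mulg1. Qed.

Lemma mem_DesL_w0 s i : (i \in DesL (w0 n ** s)) = (rev_ord i \notin DesL s).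
Proof.
rewrite mem_DesL mem_DesLN comppV !comppE.
have w0V : (w0 n)^-1%g = w0 n by apply/eqP; rewrite eq_invg_mul; apply/eqP/w0K.
rewrite w0V w0_rev !permE.
have -> : rev_ord (hi i) = lo (rev_ord i) by apply: val_inj => /=; lia.
have -> // : rev_ord (lo i) = hi (rev_ord i).
by apply: val_inj => /=; have := ltn_ord i; lia.
Qed.

(** The ascents of [s] split into those before [x] and those from [x] on; reversal turns the latter
    into the descents of [w0 n ** s] before [w0 n x]. *)
Lemma below_DesL_w0 s x :
  below (DesL (w0 n ** s)) (w0 n x) + below (~: DesL s) x = #|~: DesL s|.
Proof.
have wx : w0 n x = n - x.+1 :> nat by rewrite w0_rev permE.
move: (DesL _) (DesL s) (mem_DesL_w0 s) => A B AE.
rewrite -(cardsID [set i : 'I_n.-1 | x <= i] (~: B)); congr (_ + _).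
  rewrite /below -(card_preimset [set i in A | i < w0 n x] (@rev_ord_inj n.-1)).
  apply: eq_card => i; rewrite !inE AE rev_ordK; congr (_ && _).
  by rewrite wx /=; have := ltn_ord i; have := ltn_ord x; lia.
by apply: eq_card => i; rewrite !inE -ltnNge andbC.
Qed.

Lemma card_DesL_w0 s : #|DesL (w0 n ** s)| = #|~: DesL s|.
Proof.
move: (DesL _) (DesL s) (mem_DesL_w0 s) => A B AE.
rewrite -(card_preimset A (@rev_ord_inj n.-1)).
by apply: eq_card => i; rewrite !inE AE rev_ordK.
Qed.

End Duality.

(** * The reflected diagram, its filling, and the conclusion *)

Lemma num_cols_diag_above S r : 0 < n -> num_cols (diag_above S r) = #|~: S|.+1.
Proof.
move=> n_gt0; rewrite /num_cols -[RHS](size_iota 1).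
apply/perm_size/uniq_perm; [exact: fset_uniq|exact: iota_uniq|move=> c].
rewrite mem_iota; apply/imfsetP/idP => /=.
  by move=> [b /mem_diag_above[x ->] ->]; rewrite /= add1n !ltnS below_le.
case: c => // c; rewrite add1n !ltnS => /= cS.
have [x xc] := below_surj n_gt0 cS; exists (pos_box S r x); rewrite /= ?xc //.
by apply/mem_diag_above; exists x.
Qed.

Lemma num_rows_diag_above S r : 0 < n -> num_rows (diag_above S r) = #|DesL r|.+1.
Proof.
move=> n_gt0; rewrite /num_rows -[RHS](size_iota 1).
apply/perm_size/uniq_perm; [exact: fset_uniq|exact: iota_uniq|move=> c].
rewrite mem_iota; apply/imfsetP/idP => /=.
  by move=> [b /mem_diag_above[x ->] ->]; rewrite /= add1n !ltnS below_le.
case: c => // c; rewrite add1n !ltnS => /= cS.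
have [x xc] := below_surj n_gt0 cS; exists (pos_box S r (r^-1%g x)).
  by apply/mem_diag_above; exists (r^-1%g x).
by rewrite /= permKV xc.
Qed.

Definition pos_box_below s S x : nat * nat :=
  ((below (~: DesL s) (s x)).+1, #|S| + 2 - (below S x).+1).

Lemma mem_diag_below s S b :
  reflect (exists x, b = pos_box_below s S x) (b \in diag_below s S).
Proof.
apply: (iffP (imfsetP _ _ _ _)) => [[c]|[x ->]].
  by rewrite inE => /(occupied_box S (~: DesL s) s)[x ->] ->; exists x.
exists ((below S x).+1, (below (~: DesL s) (s x)).+1) => //; rewrite inE.
by apply/(occupied_box S (~: DesL s) s); exists x.
Qed.

(** The flip undoes the reflection: [below_DesL_w0] recovers the row, and the bound on [below S x]
    keeps truncated subtraction exact. *)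
Lemma fill_swE s S x : 0 < n ->
  fill_sw s S (pos_box_below s S x) =
  fill_ne n (diag_above (~: S) (w0 n ** s)) (pos_box (~: S) (w0 n ** s) x).
Proof.
move=> n_gt0; rewrite /fill_sw /star_fill; congr fill_ne.
rewrite num_cols_diag_above // num_rows_diag_above // setCK card_DesL_w0.
rewrite /flip /pos_box /pos_box_below /= setCK comppE.
have := below_DesL_w0 s (s x); have := below_le S x => h1 h2.
by move: #|S| #|~: DesL s| h1 h2 => p e *; congr pair; lia.
Qed.

End Diagram.

Theorem theorem4p12 (n : nat) (n_gt0 : 0 < n) (S : {set 'I_n.-1})
    (rho sigma : 'S_n) :
  leL (w0_of S) rho -> leL sigma (w1_of S) ->
  let C_above := classD (intervalL (w0_of S) rho) in
  let C_below := classD (intervalL sigma (w1_of S)) in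
  let D_above := diag_above S rho in
  let D_below := diag_below sigma S in
  [/\ is_min_class C_above (intervalL (w0_of S) rho),
      is_max_class C_above (SigmaL (fill_poset D_above (fill_ne n D_above))),
      is_min_class C_below (SigmaL (fill_poset D_below (fill_sw sigma S)))
    & is_max_class C_below (intervalL sigma (w1_of S))].
Proof.
move=> wr sw C_above C_below D_above D_below.
have wr' : leL (w0_of (~: S)) (w0 n ** sigma) by rewrite -w0_w1 leL_w0.
pose Q := ltI sigma (w1_of S); pose Q' := ltI (w0_of (~: S)) (w0 n ** sigma).
have QE x y : Q' x y = Q y x by rewrite /Q' -w0_w1 ltI_w0.
have QE' x y : Q x y = Q' y x by rewrite QE.
have Q'ne x y : Q' x y -> x != y by case/andP => /ltn_val_perm.
split.
(* The interval is its own translate by the identity, which [box_min] shows to be minimal. *)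
- rewrite -(shift1 (w0_of S)) -(shift1 rho).
  apply: is_min_class_compat => //; first exact: compat1.
  by move=> psi; apply: one_le_compat.
- have [phi [phiC phimax phiE]] := diag_above_filling wr.
  rewrite (SigmaL_shift wr phiC (mem_diag_above S rho) (ltI_pos_box wr) phiE).
  exact: is_max_class_compat.
(* The relabelling that is maximal for [Q'] is compatible with the opposite poset [Q] and minimal
   there. *)
- have [phi [phiC phimax phiE]] := diag_above_filling wr'.
  have phiC' := compat_dual QE' phiC.
  rewrite (SigmaL_shift sw phiC' (mem_diag_below sigma S)).
  + apply: is_min_class_compat => // psi psiC.
    by apply: (le_compat_dual Q'ne QE'); apply/phimax/(compat_dual QE psiC).
  (* The reflection exchanges the two coordinates and reverses both, as the passage from [Q'] to [Q]
     requires. *)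
  + move=> x y; rewrite -/(Q x y) QE' /Q' ltI_pos_box // eq_sym.
    rewrite /pos_box /pos_box_below /= setCK !comppE.
    have := below_DesL_w0 sigma (sigma x); have := below_DesL_w0 sigma (sigma y).
    have := below_le S x; have := below_le S y.
    by move: #|S| #|~: DesL sigma| => p e; case: (x != y) => //=; lia.
  + by move=> x; rewrite fill_swE.
- rewrite -(shift1 sigma) -(shift1 (w1_of S)).
  apply: is_max_class_compat => //; first exact: compat1.
  move=> psi psiC; apply: (le_compat_dual Q'ne QE'); apply: one_le_compat => //.
  exact: compat_dual QE psiC.
Qed.
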